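(* Let $\alpha\in(0,1)$, and let the dimension $d=d_n\ge2$ vary arbitrarily with $n$. As long as $\sup_{P\in\mathcal{P}^{\le3}}|\Theta(P)|=o(n^{1/2})$, the confidence set $\widehat\Theta^{\mathrm{uni}}_{\mathrm{DA}}$ produced by the two-step construction satisfies $$\liminf_{n\to\infty}\ \inf_{P\in\mathcal{P}^{\le3}}P\bigl(\Theta(P)\subseteq\widehat\Theta^{\mathrm{uni}}_{\mathrm{DA}}\bigr)\ \ge\ 1-\alpha .$$
   Context: Notation: $[d]=\{1,\dots,d\}$; $\bm X_1,\dots,\bm X_{2n}$ are i.i.d. from $P$ on $\mathbb{R}^d$ with mean $\bm\mu=(\mu_1,\dots,\mu_d)^\top$; $\Theta(P)=\arg\min_{k\in[d]}\mu_k$ is the set of all minimizing indices; $z_{1-c}$ is the $1-c$ standard normal quantile; $a\vee b=\max(a,b)$. ''sargmin'' is the smallest index attaining the minimum. Class: $\mathcal{P}^{\le3}=\mathcal{P}^{\le3}_n$ is a collection of distributions $P$ on $\mathbb{R}^{d}$ such that, for every $r\in\Theta(P)$, $$\max_{k\in[d]\setminus\{r\}}\mathbb{E}_P\left[\frac{|W_k|^3}{\{\mathbb{E}_P[W_k^2]\}^{3/2}}\right]\le C,\qquad W_k=(\bm e_r-\bm e_k)^\top(\bm X-\bm\mu),$$ where $C>0$ is a universal constant (independent of $n,d,P$) and $\mathbb{E}_P[W_k^2]>0$. DA argmin test $\psi_j(S,c)$ of $H_0:j\in\Theta$ on a dataset $S$ at level $c$: split $S$ into a first half and a second half (of equal size,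 up to rounding); let $m$, $\overline{\bm X}^{(1)}$, $\widehat{\bm\Sigma}^{(1)}$ be the size, sample mean and sample covariance matrix of the first half, and $\overline{\bm X}^{(2)}$, $\widehat{\bm\Sigma}^{(2)}$ the sample mean and covariance of the second half. With $\bm\gamma_k=\bm e_j-\bm e_k$, let $\widehat s$ be either $\mathrm{sargmin}_{k\ne j}\overline X^{(2)}_k$ or $\mathrm{sargmin}_{k\ne j}(\overline X^{(2)}_k-\overline X^{(2)}_j)/\bigl(\sqrt{\bm\gamma_k^\top\widehat{\bm\Sigma}^{(2)}\bm\gamma_k}\vee\kappa\bigr)$ with $\kappa>0$ a fixed constant. Reject iff $\sqrt m\,\bm\gamma_{\widehat s}^\top\overline{\bm X}^{(1)}>z_{1-c}\sqrt{\bm\gamma_{\widehat s}^\top\widehat{\bm\Sigma}^{(1)}\bm\gamma_{\widehat s}}$. Two-step construction at level $\alpha$. Let $D=\{\bm X_1,\dots,\bm X_{2n}\}$ (with first half $D_1 = \{\bm X_1,\dots,\bm X_n\}$ and second half $D_2=\{\bm X_{n+1},\dots,\bm X_{2n}\}$ in the full-sample test). 1. Pre-screening: $\widehat\Theta^{(2)}=\{k\in[d]:\psi_k(D_2,n^{-1/2})\text{ does not reject}\}$. 2. Final inference: with $\alpha'=\alpha/(1\vee|\widehat\Theta^{(2)}|)$, $\ \widehat\Theta^{\mathrm{uni}}_{\mathrm{DA}}=\{k\in[d]:\psi_k(D,\alpha')\text{ does not reject}\}$. *)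

(* Defs.v *)
From HB Require Import structures.
From mathcomp Require Import all_boot all_order all_algebra.
From mathcomp Require Import all_classical all_reals all_analysis.

Set Implicit Arguments.
Unset Strict Implicit.
Unset Printing Implicit Defensive.

Import Order.TTheory GRing.Theory Num.Theory.
Import numFieldNormedType.Exports.

Local Open Scope classical_set_scope.
Local Open Scope ring_scope.

Definition cons_pair (T : Type) (n : nat) (p : T * n.-tuple T) : n.+1.-tuple T :=
  [the n.+1.-tuple T of p.1 :: p.2].

Section cons_pair_mfun.
Context d (T : measurableType d) (n : nat).

Let measurable_cons_pair :
  measurable_fun [set: T * n.-tuple T] (@cons_pair T n).
Proof. exact: measurable_cons. Qed.

HB.instance Definition _ :=
  isMeasurableFun.Build _ _ _ _ (@cons_pair T n) measurable_cons_pair.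

End cons_pair_mfun.

(** The N-fold product measure: the joint law of N independent draws from P. *)
Fixpoint iid_law d (T : measurableType d) (R : realType) (P : probability T R)
    (N : nat) : probability (N.-tuple T) R :=
  match N with
  | 0 => dirac [tuple]
  | N'.+1 => distribution (P \x iid_law P N')%E (@cons_pair T N')
  end.

Section population.
Context (R : realType) (d : nat).
Implicit Types (P : probability (d.-tuple R) R) (x : d.-tuple R) (v : 'cV[R]_d).

Definition colvec x : 'cV[R]_d := \col_k tnth x k.

Definition contrast (j k : 'I_d) : 'cV[R]_d := delta_mx j 0 - delta_mx k 0.

Definition dot (u v : 'cV[R]_d) : R := (u^T *m v) 0 0.

Definition mean P : 'cV[R]_d := \col_k fine 'E_P[fun x => tnth x k].

Definition Theta P : {set 'I_d} :=
  [set k | [forall l, mean P k 0 <= mean P l 0]].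

Definition W P (r k : 'I_d) (x : d.-tuple R) : R :=
  dot (contrast r k) (colvec x - mean P).

(** Coordinates are required to be integrable so that [mean P] is the mean, and
    the second moment of W_k to be finite since [fine +oo = 0]. *)
Definition third_moment_class (C : R) P : Prop :=
  (forall k : 'I_d, P.-integrable setT (fun x => (tnth x k)%:E)) /\
  forall r k : 'I_d, r \in Theta P -> k != r ->
    let EW2 := ('E_P[(fun x => W P r k x ^+ 2)%R])%E in
    (0 < EW2 < +oo)%E /\
    ('E_P[(fun x => `|W P r k x| ^+ 3 / fine EW2 `^ (3 / 2))%R] <= C%:E)%E.

End population.

(** The p-quantile of N(0, 1), meaningful for p in ]0, 1[: for the other values
    of p the set is empty or unbounded below and the infimum is a default
    value. *)
Definition std_normal_quantile (R : realType) (p : R) : R :=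
  inf [set t | (p%:E <= normal_prob (0 : R) 1 `]-oo, t])%E].

Section DA.
Context (R : realType) (d : nat).
Implicit Types (S : seq (d.-tuple R)).

Definition sample_mean S : 'cV[R]_d :=
  (size S)%:R^-1 *: \sum_(x <- S) colvec x.

Definition sample_cov S : 'M[R]_d :=
  (size S).-1%:R^-1 *:
    \sum_(x <- S) (colvec x - sample_mean S) *m (colvec x - sample_mean S)^T.

Definition contrast_var S (j k : 'I_d) : R :=
  dot (contrast R j k) (sample_cov S *m contrast R j k).

(** Ties go to the smallest index. The default j is never used when d >= 2. *)
Definition sargmin (j : 'I_d) (f : 'I_d -> R) : 'I_d :=
  odflt j [pick s | [&& s != j,
                        [forall l, (l != j) ==> (f s <= f l)]
                      & [forall l, (l != j) && (f l == f s) ==> (s <= l)%N]]].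

Definition selected (studentize : bool) (kappa : R) (j : 'I_d) S : 'I_d :=
  if studentize then
    sargmin j (fun k => (sample_mean S k 0 - sample_mean S j 0) /
                        Num.max (Num.sqrt (contrast_var S j k)) kappa)
  else sargmin j (fun k => sample_mean S k 0).

(** [fsthalf N] is the size of the first half of a dataset of size N, so that
    the rounding used for odd N is left to the caller. *)
Definition rejects (fsthalf : nat -> nat) (studentize : bool) (kappa : R)
    (j : 'I_d) S (c : R) : bool :=
  let m := fsthalf (size S) in
  let S1 := take m S in
  let S2 := drop m S in
  let s := selected studentize kappa j S2 in
  std_normal_quantile (1 - c) * Num.sqrt (contrast_var S1 j s)
    < Num.sqrt m%:R * dot (contrast R j s) (sample_mean S1).

Definition confidence_set fsthalf studentize kappa S (c : R) : {set 'I_d} :=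
  [set k | ~~ rejects fsthalf studentize kappa k S c].

(** D has size 2n. *)
Definition prescreened fsthalf studentize kappa (n : nat) (D : seq (d.-tuple R)) :=
  confidence_set fsthalf studentize kappa (drop n D) (Num.sqrt n%:R)^-1.

Definition Theta_uni fsthalf studentize kappa (alpha : R) (n : nat)
    (D : seq (d.-tuple R)) : {set 'I_d} :=
  confidence_set fsthalf studentize kappa D
    (alpha / (maxn 1 #|prescreened fsthalf studentize kappa n D|)%:R).

End DA.

(* Main.v *)
(** Conditionally on the second half of the data the selected index is fixed, so
    it suffices to bound, for a mean-zero [X] with bounded third moment, the
    probability that the t-statistic of [m] i.i.d. copies exceeds [z], where
    [z] is the [1 - c] normal quantile and the prescreening guarantees that the
    level [c] may be taken to be [alpha / #|Theta|].  As [#|Theta| = o(sqrt n)],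
    an error [o(1) c + O(1 / sqrt m)] is affordable, and a Berry-Esseen theorem
    for t-statistics is not needed.

    By monotonicity in [c] only [c >= 1 / sqrt m], that is [z = O(sqrt (ln m))],
    matters.  For [z >= 0] the denominator of the t-statistic only hurts when it
    is small, which has exponentially small probability since squares are
    nonnegative; for [z < 0] a law of large numbers is enough.  The numerator is
    compared with the heat flow [u (v, x) = P (x + sqrt v Z >= 0)] by Lindeberg's
    telescoping: [u] solves the heat equation in closed form, and its third
    derivative is dominated by the tilt [exp (l x + l^2 v / 2)].  With [l = z] the
    accumulated error is [m^(-1/2 + o(1)) exp (- z^2 / 2)], hence negligible
    relative to the Gaussian tail, while the jumps exceeding 1 contribute
    [O(1 / sqrt m)] through the third moment. *)
From HB Require Import structures.
Require Import Defs.
From mathcomp Require Import all_boot all_order all_algebra.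
From mathcomp Require Import all_classical all_reals all_analysis.
From mathcomp Require Import measurable_realfun measurable_fun_approximation.
From mathcomp Require Import ring lra.
Import Order.TTheory GRing.Theory Num.Theory.
Import numFieldNormedType.Exports.
Local Open Scope classical_set_scope.
Local Open Scope ring_scope.
Set Implicit Arguments.
Unset Strict Implicit.
Unset Printing Implicit Defensive.

(** Everything is measured on one scale: with w = [log_scale m], [q = expR (w ^+ 2)] is the
    hundredth root of m, and [y = expR (10 * w)] bounds exp |z| for the quantiles that matter.
    Powers of z and exponentials in z are absorbed into powers of y, the losses of smoothing into
    powers of q, and y ^ 9 / q tends to 0.

    The indicator of a half-line is not smooth, so the heat flow is started at time q ^ -2, where
    derivatives cost at most q ^ 7. At that time it no longer dominates the indicator; multiplied by
    M with [1 <= M * tail (- L)] it does so beyond L / q, and M can be taken as close to 1 as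
    desired.

    With three moments only, no exponential moment is available. Since probabilities are at most 1,
    the backward induction may truncate each step at 1, and this truncation is where large jumps are
    paid for.

    The dimension disappears because the bounds for the possible values of the selected index are
    averaged with weights that sum to at most 1. Prescreening is the same test at level n ^ (-1/2),
    so its union bound over Theta costs O(#|Theta| / sqrt n). *)

Section deriv_rules.
Context {R : realType}.
Implicit Types f g : R -> R.

Definition der f x l := is_derive (x : R^o) (1 : R^o) (f : R^o -> R^o) l.

Lemma der_eq f x l l' : der f x l -> l = l' -> der f x l'.
Proof. by move=> ? <-. Qed.

Lemma der_cst (c x : R) : der (fun=> c) x 0.
Proof. exact: is_derive_cst. Qed.

Lemma der_id (x : R) : der (fun y => y) x 1.
Proof. exact: is_derive_id. Qed.

Lemma derD f g x l l' : der f x l -> der g x l' ->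
  der (fun y => f y + g y) x (l + l').
Proof. exact: is_deriveD. Qed.

Lemma derN f x l : der f x l -> der (fun y => - f y) x (- l).
Proof. exact: is_deriveN. Qed.

Lemma derM f g x l l' : der f x l -> der g x l' ->
  der (fun y => f y * g y) x (f x * l' + g x * l).
Proof. move=> df dg; exact: (@is_deriveM _ _ f g _ _ _ _ df dg). Qed.

Lemma der_comp f g x l l' : der g (f x) l -> der f x l' ->
  der (fun y => g (f y)) x (l * l').
Proof. move=> dg df; exact: (@is_derive1_comp _ g f x l l' dg df). Qed.

Lemma der_expR (x : R) : der expR x (expR x).
Proof. exact: is_derive_expR. Qed.

Lemma der_ln (x : R) : 0 < x -> der (@ln R) x x^-1.
Proof. exact: is_derive1_ln. Qed.

Lemma der_continuous f x l : der f x l -> {for x, continuous f}.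
Proof. by move=> [df _]; apply: differentiable_continuous; apply/derivable1_diffP. Qed.

Lemma mvt_ex f f' a b : a <= b ->
  (forall x, a <= x <= b -> der f x (f' x)) ->
  exists2 c, a <= c <= b & f b - f a = f' c * (b - a).
Proof.
move=> ab df.
have [||c] := @MVT_segment R f f' a b ab.
- by move=> x; rewrite in_itv/= => /andP[ax xb]; apply: df; rewrite !ltW.
- apply: continuous_in_subspaceT => x; rewrite inE/= in_itv/= => /df.
  exact: der_continuous.
- by rewrite in_itv/= => ? ?; exists c.
Qed.

End deriv_rules.

(** * Gaussian tail and quantiles *)

Section gaussian.
Context {R : realType}.
Implicit Types y z : R.

Definition peak : R := (Num.sqrt (pi *+ 2))^-1.

Definition phi (y : R) : R := peak * expR (- (y ^+ 2 / 2)).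

Lemma normal_pdf01 y : normal_pdf 0 1 y = phi y.
Proof.
rewrite normal_pdfE ?oner_neq0// /phi /peak /normal_peak /normal_fun expr1n subr0 mul1r.
by rewrite mulNr.
Qed.

Definition tail (y : R) : R := 1 - fine (normal_prob 0 1 `]-oo, y]).

Lemma peak_gt0 : 0 < peak :> R.
Proof. by rewrite invr_gt0 sqrtr_gt0 mulrn_wgt0 ?pi_gt0. Qed.

Lemma peak_le1 : peak <= 1 :> R.
Proof.
have p0 : 0 < Num.sqrt (pi *+ 2) :> R by rewrite sqrtr_gt0 mulrn_wgt0 ?pi_gt0.
rewrite /peak invf_le1// -{1}(sqrtr1 R) ler_wsqrtr//.
have := @pi_ge2 R; rewrite mulr2n; lra.
Qed.

Lemma phi_gt0 y : 0 < phi y.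
Proof. by rewrite mulr_gt0 ?peak_gt0 ?expR_gt0. Qed.

Lemma der_tail y : der tail y (- phi y).
Proof.
pose F (x : R) : R := (\int[@lebesgue_measure R]_(t in `]-oo, x]) (normal_pdf 0 1 t))%R.
have [dF F'] : derivable (F : R^o -> R^o) (y : R^o) 1 /\ derive1 F y = phi y.
  rewrite -normal_pdf01.
  apply: (@continuous_FTC1 R (normal_pdf 0 1) -oo%O y (y + 1)).
  - by rewrite ltrDl.
  - exact: integrableS (integrable_normal_pdf 0 1).
  - by rewrite ltNyr.
  - by apply: continuous_normal_pdf; rewrite oner_neq0.
have dF2 : der F y (phi y) by rewrite -F' derive1E; exact: derivableP.
have := derD (der_cst 1 y) (derN dF2).
by rewrite add0r.
Qed.

Lemma tail_ge0 y : 0 <= tail y.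
Proof.
rewrite subr_ge0 -lee_fin fineK ?fin_num_measure//.
exact: (@probability_le1 _ _ _ (normal_prob 0 1)).
Qed.

Lemma tail_le1 y : tail y <= 1.
Proof. by rewrite /tail lerBlDr lerDl fine_ge0. Qed.

Lemma cdf01 y : normal_prob 0 1 `]-oo, y] = (1 - tail y)%:E.
Proof. by rewrite /tail opprB addrC subrK fineK// fin_num_measure. Qed.

Lemma tail_mvt y z : y <= z ->
  exists2 c, y <= c <= z & tail y - tail z = phi c * (z - y).
Proof.
move=> yz; have [//|c cyz E] := @mvt_ex R tail (fun x => - phi x) y z yz.
  by move=> x _; exact: der_tail.
by exists c => //; rewrite -[LHS]opprB E mulNr opprK.
Qed.

Lemma tail_nincr y z : y <= z -> tail z <= tail y.
Proof.
move=> yz; have [c _ E] := tail_mvt yz.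
by rewrite -subr_ge0 E mulr_ge0 ?subr_ge0// ltW ?phi_gt0.
Qed.

Lemma phi_le y z : phi y <= phi z * expR (`|z| * `|z - y|).
Proof.
rewrite /phi -mulrA -expRD ler_pM2l ?peak_gt0// ler_expR.
rewrite -normrM; have := ler_norm (z * (z - y)).
have : 0 <= (z - y) ^+ 2 by rewrite sqr_ge0.
nra.
Qed.

Lemma phi_ge y z : phi z * expR (- (`|z| * `|z - y| + `|z - y| ^+ 2 / 2)) <= phi y.
Proof.
rewrite /phi -mulrA -expRD ler_pM2l ?peak_gt0// ler_expR.
rewrite -normrM; have := ler_norm (- (z * (z - y))).
rewrite normrN real_normK ?num_real//.
nra.
Qed.

(** Integrating the density over a window of length 1 / (1 + |z|), where it drops by a factor of at
    most e^2, gives this Mills-type bound. It turns errors measured in [phi] into errors relative to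
    [tail]. *)
Lemma phi_le_tail z : phi z <= expR 2 * (1 + `|z|) * tail z.
Proof.
have z1 : 0 < 1 + `|z| by rewrite ltr_pwDl.
set h := (1 + `|z|)^-1.
have h0 : 0 < h by rewrite invr_gt0.
have h1 : h <= 1 by rewrite invf_le1 // lerDl.
have zh1 : `|z| * h <= 1 by rewrite ler_pdivrMr// mul1r lerDr.
have [|c /andP[zc cz] E] := @tail_mvt z (z + h); first by rewrite lerDl ltW.
have -> : expR 2 * (1 + `|z|) * tail z = expR 2 * h^-1 * tail z by rewrite /h invrK.
have : h * phi c <= tail z.
  have Eh : z + h - z = h by ring.
  by move: E; rewrite Eh mulrC; have := tail_ge0 (z + h); lra.
move=> H; rewrite mulrAC ler_pdivlMr//.
apply: (@le_trans _ _ (expR 2 * (h * phi c))); last by rewrite ler_pM2l ?expR_gt0.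
rewrite (mulrCA (expR 2)) (mulrC _ h) ler_pM2l// mulrC -ler_pdivrMr ?expR_gt0// -expRN.
apply: le_trans (phi_ge c z); rewrite ler_pM2l ?phi_gt0// ler_expR lerN2.
have ch : `|z - c| <= h by rewrite ler0_norm; lra.
have : `|z| * `|z - c| <= 1.
  by apply: le_trans zh1; rewrite ler_wpM2l.
have : `|z - c| ^+ 2 <= 1.
  by rewrite expr_le1//; apply: le_trans ch h1.
lra.
Qed.

Lemma tail_gt0 z : 0 < tail z.
Proof.
have e2 : 0 < expR 2 * (1 + `|z|) by apply: mulr_gt0; [exact: expR_gt0|rewrite ltr_pwDl].
by rewrite -(pmulr_rgt0 _ e2); apply: lt_le_trans (phi_gt0 z) (phi_le_tail z).
Qed.

Lemma tail_shift z e : 0 <= e -> tail (z - e) <= tail z + e * expR (`|z| * e) * phi z.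
Proof.
move=> e0; have [|c /andP[zc cz] E] := @tail_mvt (z - e) z; first by rewrite gerBl.
rewrite -lerBlDl E opprB addrC addrNK.
have H : phi c <= phi z * expR (`|z| * e).
  apply: le_trans (phi_le c z) _; rewrite ler_pM2l ?phi_gt0// ler_expR.
  by rewrite ler_wpM2l// ger0_norm; lra.
by rewrite (mulrC (phi c)) -mulrA ler_wpM2l// (mulrC (expR _)).
Qed.

End gaussian.

Section gaussian_quantile.
Context {R : realType}.
Implicit Types c y z t : R.

(** As a random variable on the line the identity has cdf [1 - tail], so the limits of a cdf at both
    ends give the limits of [tail]. *)
Let idR : measurableTypeR R -> R := idfun.

#[local] HB.instance Definition _ :=
  @isMeasurableFun.Build _ _ _ _ idR (@measurable_id _ _ setT).

Lemma tail_cvg0 (e : R) : 0 < e -> exists t : R, tail t < e.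
Proof.
move=> e0.
have := @cvg_cdfy1 _ _ R (normal_prob 0 1) (idR : {RV _ >-> _}).
move=> /fine_cvgP[_ /cvgrPdist_lt/(_ e e0)] [M [_ HM]].
exists (M + 1); have := HM (M + 1); rewrite ltrDl ltr01 => /(_ isT).
apply: le_lt_trans; rewrite /= /cdf /distribution /pushforward preimage_id cdf01 /=.
set T0 := tail _.
have -> : (1 - (1 - T0)) = T0 by ring.
by rewrite ger0_norm// tail_ge0.
Qed.

Lemma tail_cvg1 (e : R) : 0 < e -> exists t : R, 1 - e < tail t.
Proof.
move=> e0.
have := @cvg_cdfNy0 _ _ R (normal_prob 0 1) (idR : {RV _ >-> _}).
move=> /fine_cvgP[_ /cvgrPdist_lt/(_ e e0)] [M [_ HM]].
exists (M - 1); have := HM (M - 1); rewrite gtrBl ltr01 => /(_ isT).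
rewrite /= /cdf /distribution /pushforward preimage_id cdf01 /=.
rewrite sub0r normrN ger0_norm ?subr_ge0 ?tail_le1//.
by rewrite ltrBlDr -ltrBlDl.
Qed.

Let qset (p : R) := [set t : R | (p%:E <= normal_prob (0 : R) 1 `]-oo, t])%E].

Lemma qsetE c t : qset (1 - c) t <-> tail t <= c.
Proof. rewrite /qset/= cdf01 lee_fin; split; lra. Qed.

Lemma has_inf_qset c : 0 < c < 1 -> has_inf (qset (1 - c)).
Proof.
move=> /andP[c0 c1]; split.
  by have [t ht] := tail_cvg0 c0; exists t; apply/qsetE; exact: ltW.
have [|t ht] := @tail_cvg1 (1 - c); first by rewrite subr_gt0.
exists t => s /qsetE sc; rewrite leNgt; apply/negP => st.
by have := tail_nincr (ltW st); lra.
Qed.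

(** The infimum is attained because [tail] is continuous: if [tail q > c], this persists up to some
    q + e, below which the set has an element. *)
Lemma tail_quantile_le c : 0 < c < 1 -> tail (std_normal_quantile (1 - c)) <= c.
Proof.
move=> c01; rewrite leNgt; apply/negP => H.
set q := std_normal_quantile _ in H.
have [e e0 He] : exists2 e : R, 0 < e & c < tail (q + e).
  have cq : {for q, continuous tail} by apply: der_continuous (der_tail q).
  have d0 : 0 < tail q - c by rewrite subr_gt0.
  move/cvgrPdist_lt : cq => /(_ _ d0)[e /= e0 He].
  exists (e / 2); first by rewrite divr_gt0.
  have := He (q + e / 2); rewrite /= opprD addrA subrr sub0r normrN ger0_norm; last lra.
  have -> : e / 2 < e by lra.
  by move=> /(_ isT); have := ler_norm (tail q - tail (q + e / 2)); lra.
have [_ hi] := has_inf_qset c01.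
have [t /qsetE tc tq] := inf_adherent e0 (has_inf_qset c01).
have : tail (q + e) <= tail t by apply: tail_nincr; exact: ltW.
lra.
Qed.

Lemma quantile_le c t : 0 < c < 1 -> tail t <= c -> std_normal_quantile (1 - c) <= t.
Proof.
move=> c01 tc; apply: ge_inf; first by have [] := has_inf_qset c01.
exact/qsetE.
Qed.

Lemma le_quantile c t : 0 < c < 1 -> c < tail t -> t <= std_normal_quantile (1 - c).
Proof.
move=> c01 tc; rewrite leNgt; apply/negP => /ltW/tail_nincr.
by have := tail_quantile_le c01; lra.
Qed.

Lemma quantile_nincr c c' : 0 < c -> c <= c' -> c' < 1 ->
  std_normal_quantile (1 - c') <= std_normal_quantile (1 - c) :> R.
Proof.
move=> c0 cc c1; apply: quantile_le; first by rewrite (lt_le_trans c0).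
apply: (le_trans _ cc); apply: tail_quantile_le; rewrite c0/=.
exact: le_lt_trans cc c1.
Qed.

(** The difference [expR (- (y ^+ 2 / 2)) - tail y] is nonincreasing from 1 on, as its derivative
    has the sign of [peak - y]; a negative value would then contradict the vanishing of [tail] at
    infinity. *)
Lemma tail_le_expR t : 1 <= t -> tail t <= expR (- (t ^+ 2 / 2)).
Proof.
move=> t1.
have D x : der (fun y => expR (- (y * y / 2)) + - tail y) x (expR (- (x * x / 2)) * (- ((x + x) / 2)) + phi x).
  apply: derD.
    apply: der_comp; first exact: der_expR.
    apply: derN; apply: (der_eq (derM (derM (der_id _) (der_id _)) (der_cst _ _))).
    by rewrite mulr0 add0r !mulr1 mulrC.
  by rewrite -[X in der _ _ X]opprK; apply: derN; exact: der_tail.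
rewrite leNgt; apply/negP => H.
have d0 : 0 < tail t - expR (- (t ^+ 2 / 2)) by rewrite subr_gt0.
have [s hs] := tail_cvg0 d0.
have ts : t <= s.
  rewrite leNgt; apply/negP => /ltW/tail_nincr.
  by have := expR_gt0 (- (t ^+ 2 / 2)); lra.
have [c /andP[tc _] E] := mvt_ex ts (fun x _ => D x).
have : (expR (- (c * c / 2)) * (- ((c + c) / 2)) + phi c) * (s - t) <= 0.
  rewrite mulr_le0_ge0 ?subr_ge0// /phi expr2.
  rewrite mulrN addrC mulrC subr_le0 (mulrC _ peak) mulrC ler_wpM2l ?expR_ge0//.
  by have := @peak_le1 R; lra.
rewrite -E -expr2.
have : 0 < expR (- (s * s / 2)) := expR_gt0 _.
lra.
Qed.

End gaussian_quantile.

(** * Heat flow of the Gaussian tail *)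

Section taylor.
Context {R : realType}.
Implicit Types (f : R -> R) (a b w y K : R).

Lemma mvt_abs f (f1 : R -> R) a b K :
  (forall x, `|x - a| <= `|b - a| -> der f x (f1 x)) ->
  (forall x, `|x - a| <= `|b - a| -> `|f1 x| <= K) ->
  `|f b - f a| <= K * `|b - a|.
Proof.
move=> df bf.
have [ab|ba] := leP a b.
  have [x /andP[ax xb]|c /andP[ac cb] ->] := @mvt_ex R f f1 a b ab.
    by apply: df; rewrite !ger0_norm ?subr_ge0 ?lerD2r.
  by rewrite normrM ler_wpM2r// bf// !ger0_norm ?subr_ge0 ?lerD2r.
have [x /andP[ax xb]|c /andP[ac cb]] := @mvt_ex R f f1 b a (ltW ba).
  by apply: df; rewrite !ler0_norm ?subr_le0 ?lerN2 ?lerD2r// ltW.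
rewrite distrC => ->; rewrite normrM (distrC a b) ler_wpM2r// bf//.
by rewrite !ler0_norm ?subr_le0 ?lerN2 ?lerD2r// ltW.
Qed.

(** The mean value bound is applied to f minus its Taylor polynomial. Iterating it loses the
    factorials of the Lagrange remainder, which only affect constants. *)
Lemma taylor2 f (f1 f2 : R -> R) y w K :
  (forall x, `|x - y| <= `|w| -> der f x (f1 x)) ->
  (forall x, `|x - y| <= `|w| -> der f1 x (f2 x)) ->
  (forall x, `|x - y| <= `|w| -> `|f2 x| <= K) ->
  `|f (y + w) - f y - w * f1 y| <= K * `|w| ^+ 2.
Proof.
move=> df df1 bf.
have ywE : y + w - y = w by ring.
have := @mvt_abs (fun x => f x + - (x * f1 y)) (fun x => f1 x - f1 y) y (y + w) (K * `|w|).
rewrite ywE expr2 mulrA => H.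
have -> : f (y + w) - f y - w * f1 y = f (y + w) - (y + w) * f1 y - (f y - y * f1 y) by ring.
apply: H => x xw.
  apply: derD; first exact: df.
  apply: derN; apply: (der_eq (derM (der_id _) (der_cst _ _))); ring.
apply: le_trans (@mvt_abs f1 f2 y x K _ _) _.
- by move=> t tx; apply: df1; exact: le_trans tx xw.
- by move=> t tx; apply: bf; exact: le_trans tx xw.
- rewrite ler_wpM2l//; apply: le_trans (bf y _); rewrite ?normr_ge0//.
  by rewrite subrr normr0.
Qed.

Lemma taylor3 f (f1 f2 f3 : R -> R) y w K :
  (forall x, der f x (f1 x)) -> (forall x, der f1 x (f2 x)) -> (forall x, der f2 x (f3 x)) ->
  (forall x, `|x - y| <= `|w| -> `|f3 x| <= K) ->
  `|f (y + w) - f y - w * f1 y - w ^+ 2 / 2 * f2 y| <= K * `|w| ^+ 3.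
Proof.
move=> df df1 df2 bf.
have K0 : 0 <= K by apply: le_trans (bf y _); rewrite ?normr_ge0// subrr normr0.
have ywE : y + w - y = w by ring.
have := @mvt_abs (fun x => f x + - (x * f1 y + (x - y) * (x - y) * (f2 y / 2)))
   (fun x => f1 x - f1 y - (x - y) * f2 y) y (y + w) (K * `|w| ^+ 2).
rewrite ywE => H.
have -> : f (y + w) - f y - w * f1 y - w ^+ 2 / 2 * f2 y =
   f (y + w) - ((y + w) * f1 y + w * w * (f2 y / 2)) - (f y - (y * f1 y + (y - y) * (y - y) * (f2 y / 2))) by field.
have -> : K * `|w| ^+ 3 = K * `|w| ^+ 2 * `|w| by ring.
apply: H => x xw.
  have dl : der (fun x => x - y) x 1.
    by apply: (der_eq (derD (der_id _) (der_cst _ _))); rewrite addr0.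
  apply: (der_eq (derD (df x) (derN (derD (derM (der_id _) (der_cst _ _)) (derM (derM dl dl) (der_cst _ _)))))).
  by field.
have xE : y + (x - y) = x by ring.
have := @taylor2 f1 f2 f3 y (x - y) K; rewrite xE => T2.
apply: (le_trans (T2 _ _ _)) => //.
- by move=> t tx; apply: bf; exact: le_trans tx xw.
- by rewrite ler_wpM2l// lerXn2r// nnegrE.
Qed.

End taylor.

Section heat.
Context {R : realType}.
Implicit Types (v y w s l q : R).

(** v ^ (-1/2), written so that the chain rule yields its derivative. *)
Definition rsqrt v : R := expR (- ln v / 2).

Lemma rsqrt_gt0 v : 0 < rsqrt v. Proof. exact: expR_gt0. Qed.

Lemma rsqrt2 v : 0 < v -> rsqrt v ^+ 2 * v = 1.
Proof.
move=> v0; rewrite /rsqrt -expRM_natl -{2}(lnK v0) -expRD.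
by rewrite [X in expR X](_ : _ = 0) ?expR0//; field.
Qed.

Lemma der_rsqrt v : 0 < v -> der rsqrt v (- (rsqrt v ^+ 3 / 2)).
Proof.
move=> v0.
have dl : der (fun v => - ln v / 2) v (- v^-1 / 2).
  by apply: (der_eq (derM (derN (der_ln v0)) (der_cst _ _))); rewrite mulr0 add0r mulrC.
apply: (der_eq (der_comp (der_expR _) dl)); rewrite -/(rsqrt v).
have := rsqrt2 v0 => H.
have -> : v^-1 = rsqrt v ^+ 2 by rewrite -[RHS](mulfK (lt0r_neq0 v0)) H mul1r.
ring.
Qed.

(* The heat flow started from the indicator function of the positive half-line. *)
Definition heat v y : R := tail (- (y * rsqrt v)).

Lemma phiN y : phi (- y) = phi y. Proof. by rewrite /phi sqrrN. Qed.

Lemma der_phi y : der phi y (- y * phi y).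
Proof.
have dq : der (fun y => - (y * y / 2)) y (- y).
  apply: derN; apply: (der_eq (derM (derM (der_id _) (der_id _)) (der_cst _ _))); by field.
have -> : phi = (fun y => peak * expR (- (y * y / 2))) :> (R -> R) by apply/funext.
apply: (der_eq (derM (der_cst _ _) (der_comp (der_expR _) dq))).
ring.
Qed.

Lemma der_heat_y v y : der (heat v) y (rsqrt v * phi (y * rsqrt v)).
Proof.
have dq : der (fun y => - (y * rsqrt v)) y (- rsqrt v).
  by apply: derN; apply: (der_eq (derM (der_id _) (der_cst _ _))); ring.
apply: (der_eq (der_comp (der_tail _) dq)).
by rewrite phiN mulrNN mulrC.
Qed.

Lemma der_heat_yy v y :
  der (fun y => rsqrt v * phi (y * rsqrt v)) y (- y * rsqrt v ^+ 3 * phi (y * rsqrt v)).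
Proof.
have dq : der (fun y => (y * rsqrt v)) y (rsqrt v).
  by apply: (der_eq (derM (der_id _) (der_cst _ _))); ring.
apply: (der_eq (derM (der_cst _ _) (der_comp (der_phi _) dq))).
by ring.
Qed.

Lemma der_heat_yyy v y :
  der (fun y => - y * rsqrt v ^+ 3 * phi (y * rsqrt v)) y
    ((y ^+ 2 * rsqrt v ^+ 5 - rsqrt v ^+ 3) * phi (y * rsqrt v)).
Proof.
have dq : der (fun y => (y * rsqrt v)) y (rsqrt v).
  by apply: (der_eq (derM (der_id _) (der_cst _ _))); ring.
have dn : der (fun y => - y * rsqrt v ^+ 3) y (- rsqrt v ^+ 3).
  by apply: (der_eq (derM (derN (der_id _)) (der_cst _ _))); ring.
apply: (der_eq (derM dn (der_comp (der_phi _) dq))).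
by ring.
Qed.

(** Half of the second space derivative in [der_heat_yy]: the heat equation. It lets the variance of
    one summand be traded for an increment of time. *)
Lemma der_heat_v v y : 0 < v ->
  der (heat^~ y) v (- y * rsqrt v ^+ 3 * phi (y * rsqrt v) / 2).
Proof.
move=> v0.
have dq : der (fun v => - (y * rsqrt v)) v (y * (rsqrt v ^+ 3 / 2)).
  apply: (der_eq (derN (derM (der_cst _ _) (der_rsqrt v0)))); ring.
apply: (der_eq (der_comp (der_tail _) dq)).
by rewrite phiN; ring.
Qed.

Lemma der_heat_vv v y : 0 < v ->
  der (fun v => - y * rsqrt v ^+ 3 * phi (y * rsqrt v) / 2) v
   ((3 * y * rsqrt v ^+ 5 - y ^+ 3 * rsqrt v ^+ 7) / 4 * phi (y * rsqrt v)).
Proof.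
move=> v0.
have dr := der_rsqrt v0.
have dq : der (fun v => y * rsqrt v) v (- (y * (rsqrt v ^+ 3 / 2))).
  apply: (der_eq (derM (der_cst _ _) dr)); ring.
have -> : (fun v => - y * rsqrt v ^+ 3 * phi (y * rsqrt v) / 2) =
   (fun v => - y * (rsqrt v * rsqrt v * rsqrt v) * phi (y * rsqrt v) / 2).
  by apply/funext => x; ring.
apply: (der_eq (derM (derM (derM (der_cst _ _) (derM (derM dr dr) dr)) (der_comp (der_phi _) dq)) (der_cst _ _))).
by field.
Qed.

(** Also a solution of the heat equation, exponential in y. An error proportional to it is carried
    through the remaining summands at the cost of third-order terms only. *)
Definition tilt l v y : R := expR (l * y + l ^+ 2 * v / 2).

(* Completing the square turns the Gaussian density into an exponential tilt. *)
Lemma phi_tilt l v y j : 0 <= l -> 0 < v <= 2 -> (j <= 3)%N ->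
  `|y| ^+ j * phi (y * rsqrt v) <= expR 9 * (1 + 2 * l) ^+ 3 * tilt l v y.
Proof.
move=> l0 /andP[v0 v2] j3.
set s : R := `|y + l * v|.
have s0 : 0 <= s by exact: normr_ge0.
have ys : `|y| <= (1 + s) * (1 + 2 * l).
  have : `|y| <= s + l * v.
    rewrite -[y in leLHS](addrK (l * v)).
    by rewrite (le_trans (ler_normB _ _))// lerD2l ger0_norm// mulr_ge0// ltW.
  have := mulr_ge0 s0 l0; have := ler_wpM2l l0 v2; nra.
have yj : `|y| ^+ j <= (1 + s) ^+ 3 * (1 + 2 * l) ^+ 3.
  rewrite -exprMn; apply: (@le_trans _ _ (((1 + s) * (1 + 2 * l)) ^+ j)).
    by apply: lerXn2r; rewrite ?nnegrE// mulr_ge0//; lra.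
  apply: ler_weXn2l => //; nra.
have s3 : (1 + s) ^+ 3 <= expR (3 * s).
  rewrite expRM_natl; apply: lerXn2r; rewrite ?nnegrE ?expR_ge0//; first by lra.
  by have := expR_ge1Dx s; lra.
have ph : phi (y * rsqrt v) <= expR (- (s ^+ 2 / 4)) * tilt l v y.
  rewrite /phi; apply: (@le_trans _ _ (expR (- ((y * rsqrt v) ^+ 2 / 2)))).
    by rewrite -[leRHS]mul1r ler_wpM2r ?expR_ge0// peak_le1.
  rewrite /tilt -expRD ler_expR exprMn.
  have /(congr1 (fun x => x / v)) := rsqrt2 v0.
  rewrite mulfK ?gt_eqF// mul1r => ->.
  have -> : s ^+ 2 = (y + l * v) ^+ 2 by rewrite /s real_normK ?num_real.
  have E : - (y ^+ 2 / v / 2) = - ((y + l * v) ^+ 2 * (v^-1 / 2)) + (l * y + l ^+ 2 * v / 2).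
    by field; rewrite gt_eqF.
  have -> : y ^+ 2 * v^-1 = y ^+ 2 / v by [].
  rewrite E lerD2r lerN2 ler_wpM2l ?sqr_ge0//.
  have : 2^-1 <= v^-1 by rewrite lef_pV2 ?posrE.
  lra.
apply: (@le_trans _ _ (expR (3 * s) * (1 + 2 * l) ^+ 3 * (expR (- (s ^+ 2 / 4)) * tilt l v y))).
  apply: ler_pM => //.
  - by rewrite ltW// phi_gt0.
  - apply: (le_trans yj); rewrite ler_wpM2r// exprn_ge0//; lra.
have -> : expR (3 * s) * (1 + 2 * l) ^+ 3 * (expR (- (s ^+ 2 / 4)) * tilt l v y) =
  (expR (3 * s) * expR (- (s ^+ 2 / 4))) * ((1 + 2 * l) ^+ 3 * tilt l v y) by ring.
rewrite -[leRHS]mulrA ler_wpM2r//.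
  by rewrite mulr_ge0 ?expR_ge0// exprn_ge0//; lra.
rewrite -expRD ler_expR.
(* 3 s - s^2 / 4 peaks at s = 6 with value 9, whence [expR 9]. *)
have : 0 <= (s - 6) ^+ 2 by rewrite sqr_ge0.
nra.
Qed.

End heat.

(** * One Lindeberg step: remainders of the heat flow in space and in time *)

Section heat_step.
Context {R : realType}.
Implicit Types (v y w s l q : R).

(** Dominates, relative to [tilt], each derivative of [heat] used below for times between q ^ -2 and
    2: there [rsqrt v] is at most q, and it occurs with power at most 7, in the second time
    derivative. *)
Definition heat_bound l q : R := 2 * expR 9 * (1 + 2 * l) ^+ 3 * q ^+ 7.

Lemma heat_bound_ge0 l q : 0 <= l -> 0 <= q -> 0 <= heat_bound l q.
Proof.
move=> l0 q0; rewrite /heat_bound !mulr_ge0 ?expR_ge0 ?exprn_ge0//; lra.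
Qed.

Lemma rsqrt_le q v : 0 < q -> 1 <= q ^+ 2 * v -> rsqrt v <= q.
Proof.
move=> q0 qv; have v0 : 0 < v.
  by rewrite -(pmulr_rgt0 _ (exprn_gt0 2 q0)) (lt_le_trans _ qv).
have r0 := rsqrt_gt0 v.
have H : rsqrt v ^+ 2 <= q ^+ 2 by rewrite -(ler_pM2r v0) rsqrt2.
by rewrite -(@ler_pXn2r _ 2)// nnegrE ltW.
Qed.

Section bounds.
Variables (l q v y : R).
Hypotheses (l0 : 0 <= l) (q1 : 1 <= q) (v2 : v <= 2) (qv : 1 <= q ^+ 2 * v).

Let q0 : 0 < q. Proof. exact: lt_le_trans q1. Qed.
Let v0 : 0 < v.
Proof. by rewrite -(pmulr_rgt0 _ (exprn_gt0 2 q0)) (lt_le_trans _ qv). Qed.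

(** Each derivative is a combination of at most two such monomials, so each monomial may use half of
    [heat_bound]. *)
Let term j k (c : R) : 0 <= c <= 1 -> (j <= 3)%N -> (k <= 7)%N ->
  `|c * (y ^+ j * rsqrt v ^+ k) * phi (y * rsqrt v)| <= heat_bound l q / 2 * tilt l v y.
Proof.
move=> /andP[c0 c1] j3 k7.
have r0 := rsqrt_gt0 v; have f0 := phi_gt0 (y * rsqrt v).
rewrite (normrM _ (phi _)) (normrM c) (normrM (y ^+ j)) (ger0_norm c0) (gtr0_norm f0) !normrX (gtr0_norm r0).
have -> : c * (`|y| ^+ j * rsqrt v ^+ k) * phi (y * rsqrt v) =
  (c * rsqrt v ^+ k) * (`|y| ^+ j * phi (y * rsqrt v)) by ring.
have -> : heat_bound l q / 2 * tilt l v y = q ^+ 7 * (expR 9 * (1 + 2 * l) ^+ 3 * tilt l v y).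
  by rewrite /heat_bound; field.
have rk : 0 <= rsqrt v ^+ k by rewrite exprn_ge0// ltW.
have yj : 0 <= `|y| ^+ j by rewrite exprn_ge0.
apply: ler_pM; [exact: mulr_ge0|exact: mulr_ge0 (ltW f0)| |].
  rewrite -[leRHS]mul1r; apply: ler_pM => //.
  apply: (@le_trans _ _ (q ^+ k)).
    by apply: lerXn2r; rewrite ?nnegrE ?(ltW q0) ?(ltW r0)// rsqrt_le.
  exact: ler_weXn2l.
by apply: phi_tilt => //; rewrite v0.
Qed.

Let half (x y' z : R) : `|x| <= z / 2 * tilt l v y -> `|y'| <= z / 2 * tilt l v y ->
  `|x - y'| <= z * tilt l v y.
Proof.
move=> hx hy; rewrite (le_trans (ler_normB _ _))//.
have -> : z * tilt l v y = z / 2 * tilt l v y + z / 2 * tilt l v y by field.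
exact: lerD.
Qed.

Let single (x : R) : `|x| <= heat_bound l q / 2 * tilt l v y -> `|x| <= heat_bound l q * tilt l v y.
Proof.
move=> H; apply: (le_trans H); rewrite ler_wpM2r ?expR_ge0//.
by have := heat_bound_ge0 l0 (ltW q0); lra.
Qed.

Lemma heat_y_bound : `|rsqrt v * phi (y * rsqrt v)| <= heat_bound l q * tilt l v y.
Proof.
apply: single; have := @term 0%N 1%N 1.
by rewrite !mul1r expr1; apply; rewrite ?ler01 ?lexx.
Qed.

Lemma heat_yy_bound :
  `|- y * rsqrt v ^+ 3 * phi (y * rsqrt v)| <= heat_bound l q * tilt l v y.
Proof.
apply: single; have := @term 1%N 3%N 1.
by rewrite !mul1r expr1 !mulNr normrN; apply; rewrite ?ler01 ?lexx.
Qed.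

Lemma heat_yyy_bound :
  `|(y ^+ 2 * rsqrt v ^+ 5 - rsqrt v ^+ 3) * phi (y * rsqrt v)| <= heat_bound l q * tilt l v y.
Proof.
rewrite mulrBl; apply: half.
  by have := @term 2%N 5%N 1; rewrite mul1r; apply; rewrite ?ler01 ?lexx.
by have := @term 0%N 3%N 1; rewrite !mul1r; apply; rewrite ?ler01 ?lexx.
Qed.

Lemma heat_vv_bound :
  `|(3 * y * rsqrt v ^+ 5 - y ^+ 3 * rsqrt v ^+ 7) / 4 * phi (y * rsqrt v)|
    <= heat_bound l q * tilt l v y.
Proof.
have -> : (3 * y * rsqrt v ^+ 5 - y ^+ 3 * rsqrt v ^+ 7) / 4 * phi (y * rsqrt v) =
  3 / 4 * (y ^+ 1 * rsqrt v ^+ 5) * phi (y * rsqrt v) -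
  4^-1 * (y ^+ 3 * rsqrt v ^+ 7) * phi (y * rsqrt v) by rewrite expr1; field.
by apply: half; apply: term => //; apply/andP; split; lra.
Qed.

End bounds.

Lemma heat_ge0 v y : 0 <= heat v y. Proof. exact: tail_ge0. Qed.
Lemma heat_le1 v y : heat v y <= 1. Proof. exact: tail_le1. Qed.

(* Beyond the unit ball the Taylor remainder is dominated by |w|^3 alone, since
   the heat flow stays in [0, 1]. *)
Lemma heat_space l q v y w : 0 <= l -> 1 <= q -> v <= 2 -> 1 <= q ^+ 2 * v ->
  heat v (y + w) <= heat v y + (rsqrt v * phi (y * rsqrt v)) * w
    + (- y * rsqrt v ^+ 3 * phi (y * rsqrt v) / 2) * w ^+ 2
    + (1 + 2 * expR l * (heat_bound l q * tilt l v y)) * `|w| ^+ 3.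
Proof.
move=> l0 q1 v2 qv.
have q0 : 0 < q by exact: lt_le_trans q1.
set a1 := rsqrt v * _; set a2 := - y * _ * _; set G := heat_bound l q * tilt l v y.
have M0 := heat_bound_ge0 l0 (ltW q0).
have G0 : 0 <= G by rewrite mulr_ge0 ?expR_ge0.
have el : 1 <= expR l by rewrite -expR0 ler_expR.
have h0 := heat_ge0 v y.
have w3 : 0 <= `|w| ^+ 3 by rewrite exprn_ge0.
have [w1|w1] := leP `|w| 1.
  have := @taylor3 R (heat v) _ _ _ y w (expR l * G) (der_heat_y v) (der_heat_yy v) (der_heat_yyy v).
  rewrite -/a1 -/a2 => /(_ _)/wrap[|H].
    move=> x xw; apply: (le_trans (heat_yyy_bound x l0 q1 v2 qv)).
    rewrite /G mulrCA ler_wpM2l// /tilt -expRD ler_expR.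
    have := ler_norm (x - y); have := mulr_ge0 l0 (normr_ge0 (x - y)); nra.
  have := ler_norm (heat v (y + w) - heat v y - w * a1 - w ^+ 2 / 2 * a2).
  have : 0 <= expR l * G * `|w| ^+ 3 by exact: mulr_ge0 (mulr_ge0 (expR_ge0 _) G0) w3.
  lra.
have H1 : - (a1 * w) <= G * `|w| ^+ 3.
  apply: le_trans (ler_norm _) _; rewrite normrN normrM.
  apply: ler_pM => //; first exact: heat_y_bound.
  by rewrite -[leLHS]expr1 ler_weXn2l// ltW.
have H2 : - (a2 * w ^+ 2) <= G * `|w| ^+ 3.
  apply: le_trans (ler_norm _) _; rewrite normrN normrM.
  apply: ler_pM => //; first exact: heat_yy_bound.
  by rewrite normrX ler_weXn2l// ltW.
have H3 : heat v (y + w) <= `|w| ^+ 3.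
  by rewrite (le_trans (heat_le1 _ _))// exprn_ege1// ltW.
have : 2 * G <= 2 * expR l * G by rewrite ler_wpM2r//; lra.
move=> /(ler_wpM2r w3); nra.
Qed.

(** The mean value theorem is used twice, for [heat] in time and for its time derivative;
    [expR (l ^+ 2 * s)] absorbs the growth of [tilt] over the time step. *)
Lemma heat_time l q v y s : 0 <= l -> 1 <= q -> 0 <= s -> v + s <= 2 -> 1 <= q ^+ 2 * v ->
  heat v y + (- y * rsqrt v ^+ 3 * phi (y * rsqrt v) / 2) * s
  <= heat (v + s) y + s ^+ 2 * (expR (l ^+ 2 * s) * (heat_bound l q * tilt l v y)).
Proof.
move=> l0 q1 s0 v2 qv.
have q0 : 0 < q by exact: lt_le_trans q1.
have M0 := heat_bound_ge0 l0 (ltW q0).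
have v0 : 0 < v by rewrite -(pmulr_rgt0 _ (exprn_gt0 2 q0)) (lt_le_trans _ qv).
pose g x := - y * rsqrt x ^+ 3 * phi (y * rsqrt x) / 2.
have [|x /andP[vx xv]|c /andP[vc cv] E] := @mvt_ex R (heat^~ y) g v (v + s).
- by rewrite lerDl.
- by apply: der_heat_v; exact: lt_le_trans vx.
pose g' x := (3 * y * rsqrt x ^+ 5 - y ^+ 3 * rsqrt x ^+ 7) / 4 * phi (y * rsqrt x).
have [x /andP[vx xc]|c' /andP[vc' cc'] E'] := @mvt_ex R g g' v c vc.
  by apply: der_heat_vv; exact: lt_le_trans vx.
have c2 : c' <= 2 by rewrite (le_trans cc')// (le_trans cv).
have qc : 1 <= q ^+ 2 * c'.
  by rewrite (le_trans qv)// ler_wpM2l// exprn_ge0// ltW.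
have B : `|g' c'| <= expR (l ^+ 2 * s) * (heat_bound l q * tilt l v y).
  apply: le_trans (heat_vv_bound y l0 q1 c2 qc) _.
  rewrite [leRHS]mulrCA ler_wpM2l// /tilt -expRD ler_expR.
  have ll : 0 <= l ^+ 2 by rewrite exprn_ge0.
  have cs : c' - v <= s by rewrite lerBlDl (le_trans cc').
  have H1 := ler_wpM2l ll cs; have H2 := mulr_ge0 ll s0; clear - H1 H2; lra.
set K := expR _ * _ in B *.
have vs : v + s - v = s by ring.
rewrite vs in E.
have H : - (g' c' * (c - v)) <= K * s.
  apply: le_trans (ler_norm _) _; rewrite normrN normrM.
  by apply: ler_pM => //; rewrite ger0_norm ?subr_ge0// lerBlDl.
have := ler_wpM2r s0 H; rewrite -E' -/(g v).
move: E; clear; move: (heat (v + s) y) (heat v y) (g c) (g v) => h' h gc gv E.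
have -> : h' = h + gc * s by rewrite -E addrC subrK.
move=> H; rewrite -subr_ge0.
have -> : h + gc * s + s ^+ 2 * K - (h + gv * s) = K * s * s - - (gc - gv) * s by ring.
by rewrite subr_ge0.
Qed.

End heat_step.

(** * Independent sequences *)

Section seq_measurability.
Context d (T : measurableType d) (R : realType).

Definition seq_measurable (A : set (seq T)) :=
  forall N, measurable [set D : N.-tuple T | A D].

Definition seq_measurable_fun d' (T' : measurableType d') (f : seq T -> T') :=
  forall N, measurable_fun setT (fun D : N.-tuple T => f D).

Implicit Types (A B : set (seq T)) (f g : seq T -> R).

Lemma seq_measurableC A : seq_measurable A -> seq_measurable (~` A).
Proof. by move=> mA N; exact: measurableC (mA N). Qed.

Lemma seq_measurableI A B : seq_measurable A -> seq_measurable B ->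
  seq_measurable (A `&` B).
Proof. by move=> mA mB N; exact: measurableI (mA N) (mB N). Qed.

Lemma seq_measurableU A B : seq_measurable A -> seq_measurable B ->
  seq_measurable (A `|` B).
Proof. by move=> mA mB N; exact: measurableU (mA N) (mB N). Qed.

Lemma seq_measurable_cst (P : Prop) : seq_measurable (fun=> P).
Proof.
move=> N; have [p|np] := pselect P.
  by rewrite [X in measurable X](_ : _ = setT)//; apply/seteqP; split.
by rewrite [X in measurable X](_ : _ = set0)//; apply/seteqP; split.
Qed.

Lemma seq_measurable_imply (b : bool) A : seq_measurable A ->
  seq_measurable (fun s => b -> A s).
Proof.
case: b => mA.
  rewrite (_ : (fun s => _) = A)//; apply/seteqP; split => s /= H //; exact: H.
by rewrite (_ : (fun s => _) = (fun=> True)); [exact: seq_measurable_cst|apply/seteqP; split].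
Qed.

Lemma seq_measurable_forall (I : finType) (A : I -> set (seq T)) :
  (forall i, seq_measurable (A i)) -> seq_measurable (fun s => forall i, A i s).
Proof.
move=> mA N.
have -> : [set D : N.-tuple T | forall i, A i D] = \bigcap_(i in [set` I]) [set D : N.-tuple T | A i D].
  by apply/seteqP; split => D /= H i => [_|]; apply: H.
by apply: fin_bigcap_measurable => // i _; exact: mA.
Qed.

Lemma seq_measurable_exists (I : finType) (A : I -> set (seq T)) :
  (forall i, seq_measurable (A i)) -> seq_measurable (fun s => exists i, A i s).
Proof.
move=> mA N.
have -> : [set D : N.-tuple T | exists i, A i D] = \bigcup_(i in [set` I]) [set D : N.-tuple T | A i D].
  by apply/seteqP; split => D /= [i]; exists i.
by apply: fin_bigcup_measurable => // i _; exact: mA.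
Qed.

Lemma seq_measurable_le f g : seq_measurable_fun f -> seq_measurable_fun g ->
  seq_measurable (fun s => f s <= g s).
Proof.
move=> mf mg N; rewrite -[X in measurable X]setTI.
exact: (measurable_fun_le measurableT (mf N) (mg N)).
Qed.

Lemma seq_measurable_lt f g : seq_measurable_fun f -> seq_measurable_fun g ->
  seq_measurable (fun s => f s < g s).
Proof.
move=> mf mg; rewrite (_ : (fun s => _) = ~` (fun s => g s <= f s)).
  exact: seq_measurableC (seq_measurable_le mg mf).
by apply/seteqP; split => s /=; rewrite ltNge => /negP.
Qed.

Lemma seq_measurable_fun_size d' (T' : measurableType d') (h : nat -> seq T -> T') :
  (forall m, seq_measurable_fun (h m)) ->
  seq_measurable_fun (fun s => h (size s) s).
Proof.
move=> mh N; apply: eq_measurable_fun (mh N N) => D _ /=.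
by rewrite size_tuple.
Qed.

Lemma seq_measurable_fun_sum (X : T -> R) : measurable_fun setT X ->
  seq_measurable_fun (fun s => \sum_(x <- s) X x).
Proof.
move=> mX N.
apply: (eq_measurable_fun (fun D : N.-tuple T => \sum_(i < N) X (tnth D i))).
  by move=> D _; rewrite [in RHS]big_tuple.
by apply: measurable_sum => i; apply: measurableT_comp => //; exact: measurable_tnth.
Qed.

Let measurable_take N m :
  measurable_fun [set: N.-tuple T] (fun D => [tuple of take m D]).
Proof.
apply/measurable_fun_tnthP => i.
have iN : (i < N)%N by rewrite (leq_trans (ltn_ord i))// geq_minr.
rewrite (_ : _ \o _ = (@tnth _ T ^~ (Ordinal iN))); first exact: measurable_tnth.
apply/funext => D /=; have x0 : T := tnth D (Ordinal iN).
rewrite !(tnth_nth x0)/= nth_take//.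
by rewrite (leq_trans (ltn_ord i))// geq_minl.
Qed.

Let measurable_drop N m :
  measurable_fun [set: N.-tuple T] (fun D => [tuple of drop m D]).
Proof.
apply/measurable_fun_tnthP => i.
have iN : (m + i < N)%N by have := ltn_ord i; rewrite ltn_subRL.
rewrite (_ : _ \o _ = (@tnth _ T ^~ (Ordinal iN))); first exact: measurable_tnth.
apply/funext => D /=; have x0 : T := tnth D (Ordinal iN).
by rewrite !(tnth_nth x0)/= nth_drop.
Qed.

Lemma seq_measurable_fun_take d' (T' : measurableType d') (f : seq T -> T') m :
  seq_measurable_fun f -> seq_measurable_fun (fun s => f (take m s)).
Proof. by move=> mf N; exact: measurableT_comp (mf _) (@measurable_take N m). Qed.

Lemma seq_measurable_take A m : seq_measurable A -> seq_measurable (fun s => A (take m s)).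
Proof.
move=> mA N; rewrite -[X in measurable X]setTI.
exact: (@measurable_take N m measurableT _ (mA _)).
Qed.

Lemma seq_measurable_drop A m : seq_measurable A -> seq_measurable (fun s => A (drop m s)).
Proof.
move=> mA N; rewrite -[X in measurable X]setTI.
exact: (@measurable_drop N m measurableT _ (mA _)).
Qed.

Lemma seq_measurable_cons A x : seq_measurable A -> seq_measurable (fun s => A (x :: s)).
Proof.
move=> mA N; rewrite -[X in measurable X]setTI.
exact: (measurable_cons (measurable_cst x) (@measurable_id _ _ setT)) (mA N.+1).
Qed.

End seq_measurability.

(** * Events under the product law, and backward induction *)

Section iid_sequences.
Context d (T : measurableType d) (R : realType) (P : probability T R).
Implicit Types (A B : set (seq T)).

(* Events are sets of sequences, which avoids casts between tuple types. *)
Definition iid_pr N A : \bar R := iid_law P N [set D : N.-tuple T | A D].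

Lemma iid_pr_ge0 N A : (0 <= iid_pr N A)%E. Proof. exact: measure_ge0. Qed.

Lemma iid_pr_le1 N A : seq_measurable A -> (iid_pr N A <= 1)%E.
Proof. by move=> mA; apply: probability_le1; exact: mA. Qed.

Lemma iid_pr_fin N A : seq_measurable A -> iid_pr N A \is a fin_num.
Proof. by move=> mA; apply: fin_num_measure; exact: mA. Qed.

Lemma iid_pr_le N A B : seq_measurable A -> seq_measurable B ->
  (forall s, size s = N -> A s -> B s) -> (iid_pr N A <= iid_pr N B)%E.
Proof.
move=> mA mB AB; apply: le_measure; rewrite ?inE; [exact: mA|exact: mB|].
by move=> D /=; apply: AB; rewrite size_tuple.
Qed.

Lemma iid_prC N A : seq_measurable A -> iid_pr N (~` A) = (1 - iid_pr N A)%E.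
Proof. by move=> mA; apply: probability_setC; exact: mA. Qed.

Lemma iid_pr_setU N A B : seq_measurable A -> seq_measurable B ->
  (iid_pr N (A `|` B) <= iid_pr N A + iid_pr N B)%E.
Proof. by move=> mA mB; apply: measureU2; [exact: mA|exact: mB]. Qed.

Lemma iid_pr_exists N (I : finType) (r : {set I}) (A : I -> set (seq T)) :
  (forall i, seq_measurable (A i)) ->
  (iid_pr N (fun s => exists2 i, i \in r & A i s) <= \sum_(i in r) iid_pr N (A i))%E.
Proof.
move=> mA; rewrite /iid_pr -big_enum/=.
rewrite (_ : [set D : N.-tuple T | _] = \big[setU/set0]_(i <- enum r) [set D : N.-tuple T | A i D]).
  elim: (enum r) => [|i s IH]; first by rewrite !big_nil measure0.
  have mB : measurable (\big[setU/set0]_(j <- s) [set D : N.-tuple T | A j D]).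
    by apply: bigsetU_measurable => j _; exact: mA.
  by rewrite !big_cons; apply: (le_trans (measureU2 _ (mA i N) mB)); rewrite leeD2l.
rewrite -bigcup_seq; apply/seteqP; split => D /= [i]; rewrite ?mem_enum.
  by move=> ir Ai; exists i => //=; rewrite mem_enum.
by rewrite /= mem_enum => ir Ai; exists i.
Qed.

Lemma iid_prS N A : seq_measurable A ->
  iid_pr N.+1 A = (\int[P]_x iid_pr N (fun s => A (x :: s)))%E.
Proof.
move=> mA; rewrite /iid_pr /= /distribution /pushforward /= /product_measure1.
apply: eq_integral => x _ /=; congr (iid_law P N _).
by apply/seteqP; split => s /=; rewrite /xsection/= inE.
Qed.

Lemma measurable_iid_pr_cons N A : seq_measurable A ->
  measurable_fun setT (fun x => iid_pr N (fun s => A (x :: s))).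
Proof.
move=> mA.
have mB : measurable (@cons_pair T N @^-1` [set D : N.+1.-tuple T | A D]).
  by rewrite -[X in measurable X]setTI; apply: measurable_funPT => //; exact: mA.
have := measurable_fun_xsection (iid_law P N) mB.
apply: eq_measurable_fun => x _ /=; congr (iid_law P N _).
by apply/seteqP; split => s /=; rewrite /xsection/= inE.
Qed.

(** Induction on a, conditioning on the first draw, which only A sees. This is the independence
    behind sample splitting. *)
Lemma iid_pr_indep a b A B : seq_measurable A -> seq_measurable B ->
  iid_pr (a + b) (fun s => A (take a s) /\ B (drop a s)) = (iid_pr a A * iid_pr b B)%E.
Proof.
elim: a A => [|a IH] A mA mB.
  have iid0 : iid_pr 0 A = (if asbool (A [::]) then 1 else 0)%E.
    rewrite /iid_pr /= diracE; case: ifPn => [/asboolP A0|/asboolP A0].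
      by rewrite mem_set.
    by rewrite memNset.
  rewrite add0n iid0 /iid_pr; case: ifPn => [/asboolP A0|/asboolP A0].
    rewrite mul1e; congr (iid_law P b _).
    by apply/seteqP; split => D /=; rewrite take0 drop0 => // -[].
  rewrite mul0e -(measure0 (iid_law P b)); congr (iid_law P b _).
  by apply/seteqP; split => D /=; rewrite take0 drop0 // => -[].
have mAB : seq_measurable (fun s => A (take a.+1 s) /\ B (drop a.+1 s)).
  exact: seq_measurableI (seq_measurable_take _ mA) (seq_measurable_drop _ mB).
rewrite addSn iid_prS// iid_prS//.
rewrite (eq_integral (fun x => iid_pr a (fun s => A (x :: s)) * iid_pr b B)%E); last first.
  by move=> x _; exact: (IH _ (seq_measurable_cons x mA) mB).
rewrite -(fineK (iid_pr_fin b mB)) ge0_integralZr//.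
- exact: measurable_iid_pr_cons.
- by rewrite lee_fin fine_ge0// iid_pr_ge0.
Qed.

Lemma iid_pr_drop a b B : seq_measurable B ->
  iid_pr (a + b) (fun s => B (drop a s)) = iid_pr b B.
Proof.
move=> mB; have := iid_pr_indep a b (@seq_measurable_cst _ T True) mB.
have -> : iid_pr a (fun=> True) = 1%E by exact: probability_setT.
rewrite mul1e => <-; congr (iid_law P (a + b) _).
by apply/seteqP; split => D //= [].
Qed.

(** Backward induction: k counts the draws still to come, and g k x bounds the probability of ending
    in B from the current sum x. The minimum with 1 is harmless because a probability is being
    bounded, and it keeps exponential g within reach of three moments. *)
Lemma supersolution N (X : T -> R) (g : nat -> R -> R) (B : set R) :
  measurable_fun setT X -> measurable B ->
  (forall k, measurable_fun setT (g k)) ->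
  (forall x, B x -> 1 <= g 0%N x) ->
  (forall k x, 0 <= g k x) ->
  (forall k x, (k < N)%N ->
     (\int[P]_t (Num.min 1 (g k (x + X t)))%R%:E <= (g k.+1 x)%:E)%E) ->
  forall x, (iid_pr N (fun s => B (x + \sum_(t <- s) X t)%R) <= (g N x)%:E)%E.
Proof.
move=> mX mB mg g0 gpos gS.
have mA x : seq_measurable (fun s => B (x + \sum_(t <- s) X t)).
  move=> N'; rewrite -[X in measurable X]setTI.
  have mS : measurable_fun setT (fun D : N'.-tuple T => x + \sum_(t <- D) X t).
    by apply: measurable_funD => //; exact: seq_measurable_fun_sum.
  exact: mS measurableT B mB.
elim: N gS => [_ x|N IH gS x].
  rewrite /iid_pr /= diracE /=; case: (boolP (_ \in _)) => [|_].
    by rewrite inE/= big_nil addr0 lee_fin => /g0.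
  by rewrite lee_fin.
rewrite iid_prS//; apply: le_trans (gS N x (ltnSn N)).
have gmin : measurable_fun setT (fun t => Num.min 1 (g N (x + X t))).
  apply: measurable_minr => //.
  by apply: measurableT_comp => //; exact: measurable_funD.
have E t : (fun s => B (x + \sum_(t <- t :: s) X t)) = (fun s => B (x + X t + \sum_(t <- s) X t)).
  by apply/funext => s; rewrite big_cons addrA.
apply: ge0_le_integral => //.
- exact: (measurable_iid_pr_cons N (mA x)).
- exact/measurable_EFinP.
- move=> t _; rewrite E EFin_min le_min iid_pr_le1//=.
  by apply: IH => k y kN; apply: gS; rewrite ltnS ltnW.
Qed.

End iid_sequences.

(** * Exponential and central limit bounds *)

Section exp_bounds.
Context {R : realType}.
Implicit Types (u w y l : R).

Lemma expRN_le u : 0 <= u -> expR (- u) <= 1 - u + u ^+ 2 / 2.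
Proof.
move=> u0.
pose f x : R := x * x / 2 + - x + - expR (- x).
have D x : der f x (x - 1 + expR (- x)).
  have De : der (fun x => expR (- x)) x (- expR (- x)).
    by apply: (der_eq (der_comp (der_expR _) (derN (der_id _)))); rewrite mulrN1.
  apply: (der_eq (derD (derD (derM (derM (der_id _) (der_id _)) (der_cst _ _)) (derN (der_id _))) (derN De))).
  by field.
have [c /andP[c0 cu] E] := mvt_ex u0 (fun x _ => D x).
have H1 : 0 <= (c - 1 + expR (- c)) * (u - 0).
  rewrite mulr_ge0 ?subr0//.
  by have := expR_ge1Dx (- c); lra.
move: E H1; rewrite /f oppr0 expR0; clear.
move: (expR (- u)) ((c - 1 + expR (- c)) * (u - 0)) => a b E ?; nra.
Qed.

(** Only large positive w threaten the expansion, and there the truncation freezes the left side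
    while the right side keeps growing. On [-1, 1] this is Taylor's formula; for w < -1 it follows
    from [expRN_le]. *)
Lemma expR_min_le l w : 0 <= l ->
  expR (l * Num.min w 1) <= 1 + l * w + l ^+ 2 * w ^+ 2 / 2 + l ^+ 3 * expR l * `|w| ^+ 3.
Proof.
move=> l0.
have T x : `|x| <= 1 ->
    expR (l * x) <= 1 + l * x + l ^+ 2 * x ^+ 2 / 2 + l ^+ 3 * expR l * `|x| ^+ 3.
  move=> x1.
  have dl t : der (fun t => l * t) t l.
    by apply: (der_eq (derM (der_cst _ _) (der_id _))); ring.
  have D (c : R) t : der (fun t => c * expR (l * t)) t (c * l * expR (l * t)).
    by apply: (der_eq (derM (der_cst _ _) (der_comp (der_expR _) (dl t)))); ring.
  have := @taylor3 R _ _ _ _ 0 x (l ^+ 3 * expR l) (D 1) (D (1 * l)) (D (1 * l * l)).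
  rewrite add0r !mul1r mulr0 expR0 !mulr1 => /(_ _)/wrap[t tx|H].
    have -> : l * l * l = l ^+ 3 by ring.
    rewrite normrM !ger0_norm ?expR_ge0 ?exprn_ge0// ler_wpM2l ?exprn_ge0//.
    rewrite ler_expR -[leRHS]mulr1 ler_wpM2l//.
    by rewrite (le_trans (ler_norm _))//; move: tx; rewrite subr0 => /le_trans; apply.
  have {}H := le_trans (ler_norm _) H; clear - H; lra.
have [w1|w1] := leP `|w| 1.
  rewrite min_l; first exact: T.
  by rewrite (le_trans (ler_norm _)).
have K0 : 0 <= l ^+ 3 * expR l by rewrite mulr_ge0 ?expR_ge0 ?exprn_ge0.
have [w0|w0] := leP w 0.
  rewrite min_l ?(le_trans w0)//.
  have := @expRN_le (- (l * w)); rewrite opprK oppr_ge0 mulr_ge0_le0// => /(_ isT).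
  have H2 := mulr_ge0 K0 (exprn_ge0 3 (normr_ge0 w)).
  move=> H1; clear - H1 H2; lra.
move: w1; rewrite gtr0_norm// => w1.
rewrite min_r ?(ltW w1)//; apply: le_trans (T 1 _) _; first by rewrite normr1.
rewrite normr1 !expr1n.
have l2 : 0 <= l ^+ 2 by rewrite exprn_ge0.
apply: lerD; last by rewrite ler_wpM2l// exprn_ege1// ltW.
apply: lerD; first by rewrite lerD2l ler_wpM2l// ltW.
by rewrite ler_wpM2r// ler_wpM2l// exprn_ege1// ltW.
Qed.

(** A cubic remainder in place of the usual quartic one, so that a third moment of X suffices when y
    is a multiple of |X|. *)
Lemma expRN_sqr_le y : 0 <= y -> expR (- y ^+ 2) <= 1 - y ^+ 2 + y ^+ 3.
Proof.
move=> y0.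
have y2 : 0 <= y ^+ 2 by rewrite exprn_ge0.
have [y1|y1] := leP y 1.
  apply: (le_trans (expRN_le y2)); rewrite lerD2l.
  rewrite -exprM /=; have : y ^+ 4 <= y ^+ 3 by rewrite ler_wiXn2l.
  have : 0 <= y ^+ 3 by rewrite exprn_ge0.
  lra.
have : expR (- y ^+ 2) <= 1 by rewrite expR_le1 oppr_le0.
have : y ^+ 2 <= y ^+ 3 by rewrite ler_weXn2l// ltW.
lra.
Qed.

Lemma expR_sqr_le y : 0 <= y <= 1 -> expR (y ^+ 2) <= 1 + y ^+ 2 + expR 1 * y ^+ 3.
Proof.
move=> /andP[y0 y1].
have y2 : 0 <= y ^+ 2 by rewrite exprn_ge0.
have y21 : y ^+ 2 <= 1 by rewrite exprn_ile1.
have := @taylor2 R expR expR expR 0 (y ^+ 2) (expR 1).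
rewrite add0r expR0 mulr1 => /(_ (fun x _ => der_expR x) (fun x _ => der_expR x)).
move=> /(_ _)/wrap[x|H].
  rewrite subr0 (ger0_norm y2) => xy; rewrite ger0_norm ?expR_ge0// ler_expR.
  by rewrite (le_trans (ler_norm _))// (le_trans xy).
have {}H := le_trans (ler_norm _) H.
have : expR 1 * `|y ^+ 2| ^+ 2 <= expR 1 * y ^+ 3.
  by rewrite ger0_norm// -exprM ler_wpM2l ?expR_ge0// ler_wiXn2l.
lra.
Qed.

End exp_bounds.

(** * Standardized variables with a bounded third moment *)

Section standardized.
Context d (T : measurableType d) (R : realType) (P : probability T R).

Record standardized (X : T -> R) (C : R) : Prop := Standardized {
  std_measurable : measurable_fun setT X ;
  std_integrable : P.-integrable setT (EFin \o X) ;
  std_mean : (\int[P]_t (X t)%:E = 0)%E ;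
  std_var : (\int[P]_t (X t ^+ 2)%:E = 1)%E ;
  std_third : (\int[P]_t (`|X t| ^+ 3)%:E <= C%:E)%E }.

(** The passage from pointwise estimates to moments: a linear term of any size is free, and the
    quadratic coefficient meets the unit variance. *)
Lemma le_integral_cubic (X : T -> R) C (G : T -> R) (a0 a1 a2 a3 : R) :
  standardized X C -> measurable_fun setT G -> (forall t, 0 <= G t) -> 0 <= a3 ->
  (forall t, G t <= a0 + a1 * X t + a2 * X t ^+ 2 + a3 * `|X t| ^+ 3) ->
  (\int[P]_t (G t)%:E <= (a0 + a2 + a3 * C)%:E)%E.
Proof.
move=> [mX iX mean var third] mG G0 a30 GX.
have mX2 : measurable_fun setT (fun t => X t ^+ 2) by exact: measurable_funX.
have mX3 : measurable_fun setT (fun t => `|X t| ^+ 3).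
  by apply: measurable_funX; exact: measurableT_comp.
have i2 : P.-integrable setT (EFin \o (fun t => X t ^+ 2)).
  apply/integrableP; split; first exact/measurable_EFinP.
  under eq_integral do rewrite /= ger0_norm ?sqr_ge0//.
  by rewrite var ltry.
have i3 : P.-integrable setT (EFin \o (fun t => `|X t| ^+ 3)).
  apply/integrableP; split; first exact/measurable_EFinP.
  under eq_integral do rewrite /= ger0_norm ?exprn_ge0//.
  by rewrite (le_lt_trans third) ?ltry.
pose U t : \bar R := ((cst a0 t)%:E + a1%:E * (X t)%:E + a2%:E * (X t ^+ 2)%:E + a3%:E * (`|X t| ^+ 3)%:E)%E.
have i0 : P.-integrable setT (EFin \o cst a0) by exact: finite_measure_integrable_cst.
have i01 : P.-integrable setT (fun t => (cst a0 t)%:E + a1%:E * (X t)%:E)%E.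
  by apply: integrableD => //; exact: integrableZl.
have i012 : P.-integrable setT (fun t => (cst a0 t)%:E + a1%:E * (X t)%:E + a2%:E * (X t ^+ 2)%:E)%E.
  by apply: integrableD => //; exact: integrableZl.
apply: (@le_trans _ _ (\int[P]_t U t)%E).
  apply: ge0_le_integral => //.
  - by move=> t _; rewrite lee_fin.
  - exact/measurable_EFinP.
  - apply: emeasurable_funD; first exact: measurable_int i012.
    by apply: measurable_funeM; exact/measurable_EFinP.
  - by move=> t _; rewrite /U /= -!EFinM -!EFinD lee_fin.
rewrite /U integralD//; last exact: integrableZl.
rewrite integralD//; last exact: integrableZl.
rewrite integralD//; last exact: integrableZl.
have -> : (\int[P]_t (cst a0 t)%:E = a0%:E)%E.
  rewrite -[LHS]/(\int[P]_t cst a0%:E t)%E integral_cst//.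
  by rewrite [X in (_ * X)%E](probability_setT P) mule1.
rewrite !integralZl// mean var mule0 adde0 mule1.
by rewrite EFinD EFinM EFinD leeD2l// lee_wpmul2l// lee_fin.
Qed.

End standardized.

Lemma measurable_ge (R : realType) (b : R) : measurable [set x : R | b <= x].
Proof.
rewrite (_ : [set x | _] = `[b, +oo[%classic); first exact: measurable_itv.
by apply/seteqP; split => x /=; rewrite in_itv/= andbT.
Qed.

(** * Chernoff bounds for sums of squares, and Lindeberg's bound for sums *)

Section tail_bounds.
Context d (T : measurableType d) (R : realType) (P : probability T R).
Implicit Types (X Y : T -> R) (C L a b e l p q z K : R).

Lemma standardized_ge0 X C : standardized P X C -> 0 <= C.
Proof.
move=> stdX; rewrite -lee_fin; apply: le_trans (std_third stdX).
by apply: integral_ge0 => t _; rewrite lee_fin exprn_ge0.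
Qed.

(** Chernoff's method with truncation: k p C + exp (x + k r), with r = sg a^2 + K C, is a
    supersolution. Draws on which exp Y is out of control may be charged to p |X|^3, and sg is the
    sign of the quadratic term. *)
Lemma chernoff_cubic X C Y m a p K (sg : R) b : standardized P X C -> 0 <= a -> 0 <= p -> 0 <= K ->
  measurable_fun setT Y ->
  (forall t (e : R), 0 <= e -> Num.min 1 (e * expR (Y t)) <=
     p * `|X t| ^+ 3 + e * (1 + sg * a ^+ 2 * X t ^+ 2 + K * `|X t| ^+ 3)) ->
  (iid_pr P m (fun s => b <= \sum_(t <- s) Y t)%R <=
     (m%:R * (p * C) + expR (m%:R * (sg * a ^+ 2 + K * C) - b))%:E)%E.
Proof.
move=> stdX a0 p0 K0 mY HY; have C0 := standardized_ge0 stdX.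
set r := sg * a ^+ 2 + K * C.
pose g k x : R := k%:R * (p * C) + expR (x + k%:R * r).
have pC : 0 <= p * C by rewrite mulr_ge0.
have -> : (fun s => b <= \sum_(t <- s) Y t) =
          (fun s => [set x : R | 0 <= x] (- b + \sum_(t <- s) Y t)) :> set (seq T).
  by apply/funext => s /=; rewrite addrC subr_ge0.
have -> : m%:R * (p * C) + expR (m%:R * r - b) = g m (- b).
  by rewrite /g [in RHS](addrC (- b)).
apply: supersolution => //.
- exact: measurable_ge.
- move=> k; apply: measurable_funD => //.
  by apply: measurableT_comp => //; exact: measurable_funD.
- move=> x /= x0; rewrite /g mul0r add0r mul0r addr0.
  by rewrite -expR0 ler_expR.
- by move=> k x; rewrite addr_ge0 ?expR_ge0// mulr_ge0.
- move=> k x _.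
  have mG : measurable_fun setT (fun t => Num.min 1 (g k (x + Y t))).
    apply: measurable_minr => //; apply: measurable_funD => //.
    by apply: measurableT_comp => //; apply: measurable_funD => //; exact: measurable_funD.
  set e := expR (x + k%:R * r).
  have e0 : 0 <= e by exact: expR_ge0.
  apply: le_trans (@le_integral_cubic _ T R P X C _ (k%:R * (p * C) + e) 0 (e * (sg * a ^+ 2)) (p + e * K) stdX mG _ _ _) _.
  + by move=> t; rewrite le_min ler01/= addr_ge0 ?expR_ge0// mulr_ge0.
  + by rewrite addr_ge0// mulr_ge0.
  + move=> t; have := HY t e e0.
    have -> : g k (x + Y t) = k%:R * (p * C) + e * expR (Y t).
      by rewrite /g /e -expRD; congr (_ + expR _); ring.
    have kpC : 0 <= k%:R * (p * C) by rewrite mulr_ge0.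
    move: (k%:R * (p * C)) (expR (Y t)) kpC; clear => u f u0 H.
    have : Num.min 1 (u + e * f) <= u + Num.min 1 (e * f).
      have [f1|f1] := leP 1 (e * f); first by rewrite ge_min lerDr u0.
      by rewrite ge_min lexx orbT.
    lra.
  + rewrite lee_fin.
    have : e * (1 + r) <= e * expR r by rewrite ler_wpM2l// expR_ge1Dx.
    have -> : g k.+1 x = k%:R * (p * C) + p * C + e * expR r.
      rewrite /g /e -expRD -natr1; congr (_ + expR _); ring.
    rewrite /r; clear; move: (expR _) => z H; lra.
Qed.

(** The exponential of [- (a ^+ 2 * X t ^+ 2)] never exceeds 1, so no draw has to be charged (p = 0)
    and the bound is purely exponential. *)
Lemma sum_sqr_lower X C m a e : standardized P X C -> 0 <= a ->
  (iid_pr P m (fun s => \sum_(t <- s) X t ^+ 2 <= m%:R * (1 - e))%R <=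
     (expR (m%:R * (C * a ^+ 3 - a ^+ 2 * e)))%:E)%E.
Proof.
move=> stdX a0.
have mX2 : measurable_fun setT (fun t => X t ^+ 2) by apply: measurable_funX; exact: std_measurable stdX.
have mS2 : seq_measurable_fun (fun s => \sum_(t <- s) X t ^+ 2) by exact: seq_measurable_fun_sum.
have mY : measurable_fun setT (fun t => - (a ^+ 2 * X t ^+ 2)).
  by apply: measurableT_comp => //; exact: measurable_funM.
have sE s : \sum_(t <- s) - (a ^+ 2 * X t ^+ 2) = - (a ^+ 2 * \sum_(t <- s) X t ^+ 2).
  by rewrite sumrN mulr_sumr.
have := @chernoff_cubic X C _ m a 0 (a ^+ 3) (-1) (- (a ^+ 2 * (m%:R * (1 - e)))) stdX a0 (lexx _) (exprn_ge0 3 a0) mY.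
move=> /(_ _)/wrap[t x x0|H].
  rewrite mul0r add0r ge_min; apply/orP; right; rewrite ler_wpM2l//.
  have := @expRN_sqr_le _ (a * `|X t|); rewrite mulr_ge0// => /(_ isT).
  rewrite !exprMn real_normK ?num_real// => H; clear - H; lra.
apply: le_trans (le_trans _ H) _.
- apply: iid_pr_le.
  + by apply: seq_measurable_le => // N; exact: measurable_cst.
  + by apply: seq_measurable_le; [move=> N; exact: measurable_cst|exact: seq_measurable_fun_sum].
  + by move=> s _ Hs; rewrite sE lerN2 ler_wpM2l// exprn_ge0.
- rewrite lee_fin mul0r mulr0 add0r ler_expR.
  by rewrite le_eqVlt; apply/orP; left; apply/eqP; ring.
Qed.

(** Draws with a |X| > 1 are charged to the third moment through p = a^3, which adds a polynomial
    term to the exponential one. *)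
Lemma sum_sqr_upper X C m a e : standardized P X C -> 0 <= a ->
  (iid_pr P m (fun s => m%:R * (1 + e) <= \sum_(t <- s) X t ^+ 2)%R <=
     (m%:R * (a ^+ 3 * C) + expR (m%:R * (expR 1 * C * a ^+ 3 - a ^+ 2 * e)))%:E)%E.
Proof.
move=> stdX a0.
have mX2 : measurable_fun setT (fun t => X t ^+ 2) by apply: measurable_funX; exact: std_measurable stdX.
have mS2 : seq_measurable_fun (fun s => \sum_(t <- s) X t ^+ 2) by exact: seq_measurable_fun_sum.
have mY : measurable_fun setT (fun t => a ^+ 2 * X t ^+ 2) by exact: measurable_funM.
have := @chernoff_cubic X C _ m a (a ^+ 3) (expR 1 * a ^+ 3) 1 (a ^+ 2 * (m%:R * (1 + e))) stdX a0
  (exprn_ge0 3 a0) (mulr_ge0 (expR_ge0 1) (exprn_ge0 3 a0)) mY.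
move=> /(_ _)/wrap[t x x0|H].
  have y0 : 0 <= a * `|X t| by rewrite mulr_ge0.
  have E2 : a ^+ 2 * X t ^+ 2 = (a * `|X t|) ^+ 2 by rewrite exprMn real_normK ?num_real.
  have [y1|y1] := leP (a * `|X t|) 1.
    rewrite ge_min; apply/orP; right.
    apply: (@le_trans _ _ (x * (1 + 1 * a ^+ 2 * X t ^+ 2 + expR 1 * a ^+ 3 * `|X t| ^+ 3))).
      rewrite ler_wpM2l// E2.
      have := @expR_sqr_le _ (a * `|X t|); rewrite y0 y1 => /(_ isT).
      rewrite !exprMn real_normK ?num_real// => H; clear - H; lra.
    by rewrite lerDr mulr_ge0 ?exprn_ge0.
  rewrite ge_min; apply/orP; left.
  apply: (@le_trans _ _ (a ^+ 3 * `|X t| ^+ 3)).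
    by rewrite -exprMn exprn_ege1// ltW.
  have K0 : 0 <= expR 1 * a ^+ 3 :> R by rewrite mulr_ge0 ?expR_ge0 ?exprn_ge0.
  rewrite lerDl mulr_ge0// addr_ge0//; last by rewrite mulr_ge0 ?exprn_ge0.
  by rewrite addr_ge0// mul1r mulr_ge0 ?sqr_ge0.
apply: le_trans (le_trans _ H) _.
- apply: iid_pr_le.
  + by apply: seq_measurable_le => // N; exact: measurable_cst.
  + by apply: seq_measurable_le; [move=> N; exact: measurable_cst|exact: seq_measurable_fun_sum].
  + by move=> s _ Hs; rewrite -mulr_sumr ler_wpM2l// exprn_ge0.
- rewrite lee_fin lerD2l ler_expR.
  by rewrite le_eqVlt; apply/orP; left; apply/eqP; ring.
Qed.

Let measurable_heat v : measurable_fun setT (@heat R v).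
Proof.
apply: continuous_measurable_fun => x.
exact: der_continuous (der_heat_y v x).
Qed.

Lemma rsqrtXN2 q : 0 < q -> rsqrt (q ^- 2) = q.
Proof.
move=> q0; apply/eqP; rewrite -(@eqrXn2 _ 2)// ?ltW ?rsqrt_gt0//.
have q2 : 0 < q ^+ 2 by rewrite exprn_gt0.
by rewrite -[X in X == _](mulfVK (lt0r_neq0 q2)) rsqrt2 ?invr_gt0// mul1r.
Qed.

(* Lindeberg's telescoping along the heat flow. A jump larger than 1 is charged
   to the third moment, so that the error terms can be tilted exponentially. *)
Lemma clt_upper X C m (L0 : R) L l q z (h := (Num.sqrt m%:R)^-1 : R) :
  standardized P X C -> 1 <= C -> (0 < m)%N -> 1 <= q -> 0 <= l -> 0 <= L0 ->
  1 <= L0 * tail (- L) ->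
  (iid_pr P m (fun s => z + L / q <= h * \sum_(t <- s) X t)%R <=
   (L0 * heat (q ^- 2 + 1) (- z) + (L0 + 1) * (C * h) +
     C * h * (L0 * (2 * expR l + expR (l ^+ 2 * h ^+ 2)) * heat_bound l q)
      * expR (l ^+ 3 * expR l * (C * h)) * tilt l (q ^- 2 + 1) (- z))%:E)%E.
Proof.
move=> stdX C1 m0 q1 l0 L00 LL; have C0 := standardized_ge0 stdX.
have mX := std_measurable stdX.
have q0 : 0 < q by exact: lt_le_trans q1.
have m0' : 0 < m%:R :> R by rewrite ltr0n.
have sm0 : 0 < Num.sqrt m%:R :> R by rewrite sqrtr_gt0.
have h0 : 0 < h by rewrite invr_gt0.
have h1 : h <= 1.
  by rewrite invf_le1// -[leLHS]sqrtr1 ler_wsqrtr// ler1n.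
have mh2 : m%:R * h ^+ 2 = 1.
  by rewrite exprVn sqr_sqrtr ?ltW// divff// gt_eqF.
pose s : R := h ^+ 2.
have s0 : 0 <= s by rewrite exprn_ge0// ltW.
pose b : R := C * h ^+ 3.
have b0 : 0 <= b by rewrite mulr_ge0 ?exprn_ge0// ltW.
pose v k : R := q ^- 2 + k%:R * s.
pose M : R := L0 * (2 * expR l + expR (l ^+ 2 * s)) * heat_bound l q.
have hb0 := heat_bound_ge0 l0 (ltW q0).
have M0 : 0 <= M by rewrite mulr_ge0// mulr_ge0// addr_ge0 ?mulr_ge0 ?expR_ge0.
pose kap : R := expR (l ^+ 3 * expR l * b).
have kap1 : 1 <= kap.
  by rewrite -[leLHS]expR0 ler_expR mulr_ge0// mulr_ge0 ?expR_ge0 ?exprn_ge0.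
(* The smoothed Gaussian tail with k draws to go, plus two accumulated errors: that of the large
   jumps, free of tilt, and the Taylor remainders carried by [tilt]. The factor [kap] per draw
   absorbs the third-order error made by [tilt] itself. *)
pose g k x : R := L0 * heat (v k) x + (L0 + 1) * k%:R * b + k%:R * b * M * kap ^+ k * tilt l (v k) x.
have mtilt v' : measurable_fun setT (@tilt R l v').
  apply: measurableT_comp => //; apply: measurable_funD => //; exact: measurable_funM.
have mg k : measurable_fun setT (g k).
  apply: measurable_funD; last by apply: measurable_funM.
  by apply: measurable_funD => //; apply: measurable_funM.
have c0 k : 0 <= (L0 + 1) * k%:R * b by rewrite mulr_ge0// mulr_ge0// addr_ge0.
have t0 k x : 0 <= k%:R * b * M * kap ^+ k * tilt l (v k) x.
  exact: (mulr_ge0 (mulr_ge0 (mulr_ge0 (mulr_ge0 (ler0n _ _) b0) M0)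
    (exprn_ge0 _ (expR_ge0 _))) (expR_ge0 _)).
have gpos k x : 0 <= g k x.
  exact: addr_ge0 (addr_ge0 (mulr_ge0 L00 (heat_ge0 _ _)) (c0 k)) (t0 k x).
have vq k : 1 <= q ^+ 2 * v k.
  rewrite mulrDr divff ?lerDl ?gt_eqF ?exprn_gt0//.
  exact: mulr_ge0 (exprn_ge0 _ (ltW q0)) (mulr_ge0 (ler0n _ _) s0).
have v2 k : (k <= m)%N -> v k <= 2.
  move=> km; rewrite /v (_ : 2 = 1 + 1)//; apply: lerD.
    by rewrite invf_le1 ?exprn_gt0// exprn_ege1.
  by rewrite -[leRHS]mh2 ler_wpM2r// ler_nat.
have -> : (fun s => z + L / q <= h * \sum_(t <- s) X t) =
          (fun s => [set x : R | L / q <= x] (- z + \sum_(t <- s) h * X t)) :> set (seq T).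
  apply/funext => u /=; rewrite -mulr_sumr.
  by rewrite -lerBlDl opprK addrC.
have E : L0 * heat (q ^- 2 + 1) (- z) + (L0 + 1) * (C * h) +
     C * h * (L0 * (2 * expR l + expR (l ^+ 2 * h ^+ 2)) * heat_bound l q)
      * expR (l ^+ 3 * expR l * (C * h)) * tilt l (q ^- 2 + 1) (- z) = g m (- z).
  have vm : v m = q ^- 2 + 1 by rewrite /v mh2.
  have mb : m%:R * b = C * h.
    by rewrite /b exprS mulrCA (mulrCA m%:R) mh2 mulr1.
  rewrite /g vm /kap -expRM_natl -(mulrA (L0 + 1)) mb; congr (_ + _ * expR _ * _).
  by rewrite [RHS]mulrCA mb.
rewrite E; apply: supersolution => //.
- exact: measurable_funM.
- exact: measurable_ge.
(* At time q ^ -2 and beyond L / q the flow is at least [tail (- L)]: this is why the threshold is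
   shifted by L / q. *)
- move=> x /= Lx; rewrite /g !(mulr0, mul0r, addr0).
  apply: (le_trans LL); rewrite ler_wpM2l// /heat tail_nincr// lerN2.
  by rewrite /v mul0r addr0 rsqrtXN2// -ler_pdivrMr.
move=> k x km.
set G0 := heat_bound l q * tilt l (v k) x.
have G00 : 0 <= G0 by rewrite mulr_ge0 ?expR_ge0.
set Tk := k%:R * b * M * kap ^+ k * tilt l (v k) x.
have Tk0 : 0 <= Tk by exact: t0.
set A1 := rsqrt (v k) * phi (x * rsqrt (v k)).
set A2 := - x * rsqrt (v k) ^+ 3 * phi (x * rsqrt (v k)) / 2.
have mG : measurable_fun setT (fun t => Num.min 1 (g k (x + h * X t))).
  apply: measurable_minr => //; apply: measurableT_comp => //.
  by apply: measurable_funD => //; exact: measurable_funM.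
apply: le_trans (@le_integral_cubic _ T R P X C _ (L0 * heat (v k) x + (L0 + 1) * k%:R * b + Tk)
  ((L0 * A1 + Tk * l) * h) ((L0 * A2 + Tk * (l ^+ 2 / 2)) * h ^+ 2)
  ((L0 * (1 + 2 * expR l * G0) + Tk * (l ^+ 3 * expR l) + 1) * h ^+ 3) stdX mG _ _ _) _.
- by move=> t; rewrite le_min ler01/=.
- rewrite mulr_ge0 ?exprn_ge0 ?(ltW h0)// addr_ge0// addr_ge0// mulr_ge0//.
    by rewrite addr_ge0// mulr_ge0// mulr_ge0 ?expR_ge0.
  by rewrite mulr_ge0 ?expR_ge0 ?exprn_ge0.
- move=> t; set w := h * X t.
  have w3 : 0 <= `|w| ^+ 3 by rewrite exprn_ge0.
  have S1 : Num.min 1 (g k (x + w)) <=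
      L0 * heat (v k) (x + w) + (L0 + 1) * k%:R * b + Tk * expR (l * Num.min w 1) + `|w| ^+ 3.
    have [w1|w1] := leP w 1.
      rewrite ge_min; apply/orP; right.
      have -> : g k (x + w) = L0 * heat (v k) (x + w) + (L0 + 1) * k%:R * b + Tk * expR (l * w).
        rewrite /g; congr (_ + _); rewrite /Tk -[RHS]mulrA; congr (_ * _).
        by rewrite /tilt -expRD; congr expR; ring.
      by rewrite lerDl.
    rewrite ge_min; apply/orP; left.
    apply: (@le_trans _ _ (`|w| ^+ 3)).
      by rewrite exprn_ege1// (le_trans (ltW w1))// ler_norm.
    rewrite lerDr.
    exact: addr_ge0 (addr_ge0 (mulr_ge0 L00 (heat_ge0 _ _)) (c0 k)) (mulr_ge0 Tk0 (expR_ge0 _)).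
  have S2 := ler_wpM2l L00 (heat_space x w l0 q1 (v2 _ (ltnW km)) (vq k)).
  have S3 := ler_wpM2l Tk0 (expR_min_le w l0).
  rewrite -/G0 -/A1 -/A2 in S2.
  have W2 : h ^+ 2 * X t ^+ 2 = w ^+ 2 by rewrite -exprMn.
  have W3 : h ^+ 3 * `|X t| ^+ 3 = `|w| ^+ 3 by rewrite normrM (gtr0_norm h0) -exprMn.
  rewrite -(mulrA _ (h ^+ 2)) W2 -(mulrA _ (h ^+ 3)) W3 -(mulrA _ h) -/w.
  move: S1 S2 S3; move: (Num.min 1 _) (heat (v k) (x + w)) (expR (l * _)) (`|w| ^+ 3).
  clear; move=> a0 a1 a2 a3; lra.
- rewrite lee_fin.
  have vS : v k + s = v k.+1 by rewrite /v -natr1 mulrDl mul1r addrA.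
  (* [A2] is half the second space derivative, hence the time derivative: the quadratic term, of
     mean s, moves [heat] from time [v k] to [v k.+1]. *)
  have := @heat_time R l q (v k) x s l0 q1 s0; rewrite vS => /(_ (v2 _ km) (vq k)).
  rewrite -/A2 -/G0 => /(ler_wpM2l L00) S1.
  (* The quadratic time error s^2 = h^4 also fits in the third-moment budget b, since h <= 1 <=
     C. *)
  have sb : s ^+ 2 <= b.
    rewrite /s /b -exprM /= -[leLHS]mul1r; apply: ler_pM => //; first by rewrite exprn_ge0// ltW.
    by rewrite ler_wiXn2l// ltW.
  have tS : tilt l (v k.+1) x = tilt l (v k) x * expR (l ^+ 2 * s / 2).
    by rewrite /tilt -vS -expRD; congr expR; field.
  have t1 : tilt l (v k) x <= tilt l (v k.+1) x.
    by rewrite tS ler_peMr ?expR_ge0// -[leLHS]expR0 ler_expR divr_ge0// mulr_ge0// exprn_ge0.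
  have S2 : Tk * (1 + l ^+ 2 * s / 2 + l ^+ 3 * expR l * b) <= 
      k%:R * b * M * kap ^+ k.+1 * tilt l (v k.+1) x.
    have -> : k%:R * b * M * kap ^+ k.+1 * tilt l (v k.+1) x = Tk * (expR (l ^+ 2 * s / 2) * kap).
      by rewrite tS /Tk exprS; ring.
    rewrite ler_wpM2l// /kap -expRD (le_trans _ (expR_ge1Dx _))//.
    by rewrite addrA.
  have S3 : L0 * (2 * expR l + expR (l ^+ 2 * s)) * b * G0 <= b * M * kap ^+ k.+1 * tilt l (v k.+1) x.
    have -> : L0 * (2 * expR l + expR (l ^+ 2 * s)) * b * G0 = b * M * tilt l (v k) x.
      by rewrite /M /G0; ring.
    rewrite -(mulrA (b * M)); apply: ler_wpM2l; first exact: mulr_ge0.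
    by apply: (le_trans t1); apply: ler_peMl; [exact: expR_ge0|exact: exprn_ege1].
  have S4 : L0 * (s ^+ 2 * (expR (l ^+ 2 * s) * G0)) <= L0 * (b * (expR (l ^+ 2 * s) * G0)).
    by rewrite ler_wpM2l// ler_wpM2r// mulr_ge0 ?expR_ge0.
  have kS : k.+1%:R = k%:R + 1 :> R by rewrite natr1.
  have bE : h ^+ 3 * C = b by rewrite mulrC.
  rewrite /g kS -(mulrA _ (h ^+ 3) C) bE; move: S1 S2 S3 S4; rewrite -/s.
  move: (tilt l (v k.+1) x) (kap ^+ k.+1) (heat (v k.+1) x) (heat (v k) x) (k%:R : R)
    (expR l) (expR (l ^+ 2 * s)).
  move: (Tk) (A2) (G0) (M) (b) (s); clear => Tk A2 G0 M b s tl kp h1 h0 k el els; lra.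
Qed.

End tail_bounds.

(** * The t-statistic *)

Section studentized_events.
Context {R : realType}.
Implicit Types (z u S e t : R).

(** Solving the self-normalised inequality for u gives u^2 (1 + k) >= z^2 (1 - e) with k = z^2 / m,
    and the root of (1 - e) / (1 + k) is at least 1 - e - k when the latter is positive. Nothing
    ties S to u here, so S < u^2 is a separate case. *)
Lemma studentized_ge0 m z u S e : (1 < m)%N -> 0 <= z -> 0 <= e ->
  m%:R * (1 - e) <= S ->
  z * Num.sqrt (m.-1%:R^-1 * (S - u ^+ 2)) < u ->
  z - z * (e + z ^+ 2 / m%:R) <= u.
Proof.
move=> m1 z0 e0 HS Hu.
have m0 : 0 < m%:R :> R by rewrite ltr0n ltnW.
have mp0 : 0 < m.-1%:R :> R by rewrite ltr0n -ltnS prednK// ltnW.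
have mpm : m.-1%:R <= m%:R :> R by rewrite ler_nat leq_pred.
have u0 : 0 < u by apply: le_lt_trans Hu; rewrite mulr_ge0 ?sqrtr_ge0.
set k := z ^+ 2 / m%:R.
have k0 : 0 <= k by rewrite divr_ge0 ?sqr_ge0// ltW.
have km : k * m%:R = z ^+ 2 by rewrite /k divfK// gt_eqF.
have [t0|t0] := leP (1 - e - k) 0.
  apply: le_trans (ltW u0); have := mulr_ge0_le0 z0 t0; clear; lra.
have H : z ^+ 2 * (1 - e) <= u ^+ 2 * (1 + k).
  have [D0|D0] := leP 0 (S - u ^+ 2).
    have D1 : (S - u ^+ 2) / m%:R <= m.-1%:R^-1 * (S - u ^+ 2).
      by rewrite mulrC ler_wpM2r// lef_pV2 ?posrE.
    have : z * Num.sqrt ((S - u ^+ 2) / m%:R) <= u.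
      by apply: le_trans (ltW Hu); rewrite ler_wpM2l// ler_wsqrtr.
    have s0 : 0 <= z * Num.sqrt ((S - u ^+ 2) / m%:R) by rewrite mulr_ge0 ?sqrtr_ge0.
    move=> /(@lerXn2r _ 2%N); rewrite !nnegrE => /(_ s0 (ltW u0)).
    rewrite exprMn sqr_sqrtr ?divr_ge0 ?(ltW m0)//.
    have -> : z ^+ 2 * ((S - u ^+ 2) / m%:R) = k * S - k * u ^+ 2 by rewrite /k; ring.
    have := ler_wpM2l k0 HS; rewrite mulrA km; clear; lra.
  have : k * (m%:R * (1 - e)) <= k * u ^+ 2.
    by rewrite ler_wpM2l// (le_trans HS)// ltW// -subr_lt0.
  rewrite mulrA km; have := sqr_ge0 u; clear; lra.
have -> : z - z * (e + k) = z * (1 - e - k) by ring.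
have zt : 0 <= z * (1 - e - k) by rewrite mulr_ge0// ltW.
rewrite -(@ler_pXn2r _ 2)// ?nnegrE//; last exact: ltW.
have k1 : 0 < 1 + k by rewrite ltr_pwDl.
rewrite -(ler_pM2r k1); apply: le_trans H.
rewrite exprMn -mulrA ler_wpM2l ?sqr_ge0//.
set t := 1 - e - k in t0 zt *.
have H1 : t * (1 + k) <= 1 - e.
  have : k * (e + k) >= 0 by rewrite mulr_ge0// addr_ge0.
  by rewrite /t; clear; lra.
have t1 : t <= 1 by rewrite /t; move: e0 k0; clear; lra.
rewrite expr2 -mulrA; apply: le_trans (ler_wpM2l (ltW t0) H1) _.
apply: ler_piMl => //; move: H1 t0 k0; clear; nra.
Qed.

(** For negative z it is a large denominator that hurts. The factor m / (m - 1) is absorbed by 4 / m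
    because e <= 1 and m >= 2, and the root of a number x >= 1 is at most x. *)
Lemma studentized_lt0 m z u S e : (1 < m)%N -> z < 0 -> 0 <= e <= 1 ->
  S <= m%:R * (1 + e) ->
  z * Num.sqrt (m.-1%:R^-1 * (S - u ^+ 2)) < u ->
  z + z * (e + 4 / m%:R) <= u.
Proof.
move=> m1 z0 /andP[e0 e1] HS Hu.
have m0 : 0 < m%:R :> R by rewrite ltr0n ltnW.
have mp0 : 0 < m.-1%:R :> R by rewrite ltr0n -ltnS prednK// ltnW.
have mE : m%:R = m.-1%:R + 1 :> R by rewrite natr1 prednK// ltnW.
apply: le_trans (ltW Hu).
have -> : z + z * (e + 4 / m%:R) = z * (1 + e + 4 / m%:R) by ring.
rewrite ler_nM2l//.
have mp1 : 1 <= m.-1%:R :> R by rewrite ler1n -ltnS prednK// ltnW.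
have m4 : 0 <= 4 / m%:R :> R by rewrite divr_ge0// ltW.
set x := 1 + e + 4 / m%:R.
have x1 : 1 <= x by rewrite /x -addrA lerDl addr_ge0.
have x0 : 0 <= x by exact: le_trans x1.
apply: (@le_trans _ _ (Num.sqrt (x ^+ 2))); last by rewrite sqrtr_sqr ger0_norm.
rewrite ler_wsqrtr//; apply: (@le_trans _ _ x); last by rewrite expr2 ler_peMr.
rewrite mulrC ler_pdivrMr//.
have : (S - u ^+ 2) <= m%:R * (1 + e) by have := sqr_ge0 u; move: HS; clear; lra.
move=> /le_trans; apply.
have E4 : 4 / m%:R * m%:R = 4 :> R by rewrite divfK// gt_eqF.
have H : 2 <= 4 / m%:R * m.-1%:R :> R.
  have -> : 4 / m%:R * m.-1%:R = 4 * m.-1%:R / m%:R :> R by ring.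
  by rewrite ler_pdivlMr// mE; move: mp1; clear; lra.
rewrite /x mE; move: H e1; rewrite mE; move: (4 / _) => w; clear; lra.
Qed.

End studentized_events.

(** * Relative effect of displacing the threshold *)

Section shifted.
Context {R : realType}.
Implicit Types (B C L q y z l r : R).

Lemma rsqrt_ge r : 0 <= r <= 1 -> 1 - r <= rsqrt (r + 1) <= 1.
Proof.
move=> /andP[r0 r1]; have v0 : 0 < r + 1 by rewrite ltr_wpDl.
have s0 := rsqrt_gt0 (r + 1); have s2 := rsqrt2 v0.
apply/andP; split.
  rewrite -(@ler_pXn2r _ 2)// ?nnegrE ?subr_ge0// ?(ltW s0)//.
  rewrite -(ler_pM2r v0) s2; move: r0 r1; clear; nra.
rewrite -(@ler_pXn2r _ 2)// ?nnegrE// ?(ltW s0)// expr1n -(ler_pM2r v0) s2.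
by rewrite mul1r lerDr.
Qed.

(** Collects three displacements of the threshold: the relative one due to the random denominator, L
    / q from smoothing, and the rescaling by the total variance 1 + q ^ -2. In 13 + 2 L the first
    accounts for 6, the second for L and the third for 7 + L. *)
Lemma shifted_quantile L q y z e : 1 <= q -> 1 <= y -> 0 <= L -> `|z| <= y ->
  0 <= e <= (y ^+ 2 + 4) / q ->
  z - (13 + 2 * L) * y ^+ 3 / q <=
    (z - `|z| * (q^-1 + e) - L / q) * rsqrt (q ^- 2 + 1).
Proof.
move=> q1 y1 L0 zy /andP[e0 eq].
have q0 : 0 < q by exact: lt_le_trans q1.
set p := q^-1.
have p0 : 0 < p by rewrite invr_gt0.
have p1 : p <= 1 by rewrite invf_le1.
have p2 : q ^- 2 = p ^+ 2 by rewrite exprVn.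
have [r1 r2] : 1 - p ^+ 2 <= rsqrt (q ^- 2 + 1) /\ rsqrt (q ^- 2 + 1) <= 1.
  by apply/andP; rewrite p2 rsqrt_ge// sqr_ge0 exprn_ile1// ltW.
move: r1 r2; move: (rsqrt _) => r r1 r2.
set n := `|z| * (p + e).
have y0 : 0 <= y by exact: le_trans y1.
have y3 : y <= y ^+ 3 by rewrite -[leLHS]expr1 ler_weXn2l.
have n0 : 0 <= n by rewrite mulr_ge0// addr_ge0// ltW.
have n6 : n <= 6 * y ^+ 3 * p.
  apply: (@le_trans _ _ (y * (p + (y ^+ 2 + 4) * p))).
    by apply: ler_pM => //; [rewrite addr_ge0// ltW|rewrite lerD2l].
  have := ler_wpM2r (ltW p0) y3; clear; nra.
have Lp : 0 <= L * p by rewrite mulr_ge0// ltW.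
set w := z - n - L / q.
have wb : `|w| <= (7 + L) * y ^+ 3.
  have -> : w = z - (n + L * p) by rewrite /w -/p; ring.
  apply: (le_trans (ler_normB _ _)); rewrite (ger0_norm (addr_ge0 n0 Lp)).
  have H1 : 6 * y ^+ 3 * p <= 6 * y ^+ 3.
    by rewrite ler_piMr// mulr_ge0// exprn_ge0.
  have H2 : L * p <= L * y ^+ 3.
    by rewrite ler_wpM2l// (le_trans p1)// (le_trans y1).
  move: zy n6 H1 H2 y3; clear; lra.
have H : w - w * r <= (7 + L) * y ^+ 3 * p.
  have -> : w - w * r = w * (1 - r) by ring.
  apply: le_trans (ler_norm _) _; rewrite normrM; apply: ler_pM => //.
  rewrite ger0_norm ?subr_ge0//.
  have : p ^+ 2 <= p by rewrite -[leRHS]expr1 ler_wiXn2l// ltW.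
  move: r1; clear; lra.
have H3 : L * p <= L * y ^+ 3 * p by rewrite -mulrA ler_wpM2l// ler_peMl ?(ltW p0)// (le_trans y1).
have wE : w = z - n - L * p by [].
move: H H3 n6; rewrite -/p wE; move: (y ^+ 3) => y'; clear; lra.
Qed.

(** One power of y comes from [phi_le_tail] and three from the displacement, which is small enough
    for the exponential in [tail_shift] to stay below e. *)
Lemma tail_shifted L q y z : 1 <= q -> expR `|z| <= y -> 0 <= L -> L * y ^+ 4 <= q ->
  tail (z - L * y ^+ 3 / q) <= (1 + expR 3 * L * y ^+ 4 / q) * tail z.
Proof.
move=> q1 zy L0 Lq.
have q0 : 0 < q by exact: lt_le_trans q1.
have zD : 1 + `|z| <= y by exact: le_trans (expR_ge1Dx _) zy.
have y1 : 1 <= y by apply: le_trans zD; rewrite lerDl.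
have y0 : 0 <= y by exact: le_trans y1.
have e0 : 0 <= L * y ^+ 3 / q by rewrite divr_ge0 ?(ltW q0)// mulr_ge0// exprn_ge0.
apply: (le_trans (tail_shift z e0)).
have t0 := tail_ge0 z.
have H : expR (`|z| * (L * y ^+ 3 / q)) <= expR 1.
  rewrite ler_expR; apply: (@le_trans _ _ (y * (L * y ^+ 3 / q))).
    by rewrite ler_wpM2r//; move: zD; clear; lra.
  rewrite (_ : _ * _ = L * y ^+ 4 / q); last by ring.
  by rewrite ler_pdivrMr// mul1r.
have H2 : phi z <= expR 2 * y * tail z.
  by apply: (le_trans (phi_le_tail z)); rewrite ler_wpM2r// ler_wpM2l ?expR_ge0.
have -> : (1 + expR 3 * L * y ^+ 4 / q) * tail z =
    tail z + L * y ^+ 3 / q * (expR 1 * (expR 2 * y * tail z)).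
  have -> : 3 = 1 + 2 :> R by ring.
  by rewrite expRD; ring.
rewrite lerD2l -mulrA; apply: ler_wpM2l => //.
by apply: ler_pM; rewrite ?expR_ge0// ltW// phi_gt0.
Qed.

Lemma expR_sqr_tail y z : expR `|z| <= y ->
  expR (- (z ^+ 2 / 2)) <= expR 2 / peak * y * tail z.
Proof.
move=> zy; have zD : 1 + `|z| <= y by exact: le_trans (expR_ge1Dx _) zy.
have -> : expR (- (z ^+ 2 / 2)) = phi z / peak.
  by rewrite /phi [RHS]mulrAC divff ?mul1r// gt_eqF// peak_gt0.
rewrite ler_pdivrMr ?peak_gt0//; apply: (le_trans (phi_le_tail z)).
have -> : expR 2 / peak * y * tail z * peak = expR 2 * y * tail z.
  by field; rewrite gt_eqF// peak_gt0.
by rewrite ler_wpM2r ?tail_ge0// ler_wpM2l ?expR_ge0.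
Qed.

(** For z >= 0, l = z is Chernoff's choice and produces exp (- z^2 / 2); for z in [-B, 0] there is
    no tilt and exp (B^2 / 2) pays for it. The factor h = q ^ -50 beats the q ^ 7 of
    [heat_bound]. *)
Lemma clt_error B C (M : R) L q y z (e : R) (l := Num.max z 0) (h := q ^- 50) :
  1 <= C -> 0 <= M -> 0 <= L -> 1 <= q -> expR `|z| <= y -> 0 <= B -> - B <= z ->
  0 <= e -> L * y ^+ 3 / q >= e -> (L + C + 1) * y ^+ 4 <= q ->
  C * h * (M * (2 * expR l + expR (l ^+ 2 * h ^+ 2)) * heat_bound l q)
      * expR (l ^+ 3 * expR l * (C * h)) * tilt l (q ^- 2 + 1) (- (z - e))
   <= 2 * (2 + expR 1) * expR (14 + B ^+ 2 / 2) / peak * C * M * (y ^+ 9 / q) * tail z.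
Proof.
move=> C1 M0 L0 q1 zy B0 Bz e0 eL Lq.
have q0 : 0 < q by exact: lt_le_trans q1.
have zD : 1 + `|z| <= y by exact: le_trans (expR_ge1Dx _) zy.
have y1 : 1 <= y by apply: le_trans zD; rewrite lerDl.
have y0 : 0 <= y by exact: le_trans y1.
have l0 : 0 <= l by rewrite le_max lexx orbT.
have lz : l <= `|z| by rewrite ge_max ler_norm normr_ge0.
have el : expR l <= y by apply: le_trans zy; rewrite ler_expR.
have ly : l <= y by apply: le_trans lz _; apply: le_trans zD; rewrite lerDr.
have h0 : 0 <= h by rewrite invr_ge0 exprn_ge0// ltW.
have C0 : 0 <= C by exact: le_trans C1.
set p := q^-1; have p0 : 0 < p by rewrite invr_gt0.
have p1 : p <= 1 by rewrite invf_le1.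
have hp k : (k <= 50)%N -> h <= p ^+ k.
  by move=> k50; rewrite /h -exprVn ler_wiXn2l// ltW.
have hp1 : h <= p by rewrite (hp 1%N).
have y4 : 1 <= y ^+ 4 by rewrite exprn_ege1.
have Lp : L * y ^+ 4 * p <= 1 /\ C * y ^+ 4 * p <= 1 /\ y ^+ 4 * p <= 1.
  by rewrite !ler_pdivrMr// !mul1r; move: Lq L0 C0 y4; clear; nra.
have [Lp1 [Cp1 yp1]] := Lp.
have lp : l * p <= 1.
  apply: le_trans yp1; rewrite ler_wpM2r ?(ltW p0)// (le_trans ly)//.
  by rewrite -[leLHS]expr1 ler_weXn2l.
have E1 : 2 * expR l + expR (l ^+ 2 * h ^+ 2) <= (2 + expR 1) * y.
  have : expR (l ^+ 2 * h ^+ 2) <= expR 1 * y.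
    rewrite -[leLHS]mulr1; apply: ler_pM; rewrite ?expR_ge0// ler_expR.
    rewrite -exprMn exprn_ile1 ?mulr_ge0//.
    by apply: le_trans lp; rewrite ler_wpM2l.
  by move: el; clear; lra.
have E2 : heat_bound l q <= 2 * expR 9 * y ^+ 6 * q ^+ 7.
  rewrite /heat_bound ler_wpM2r ?exprn_ge0 ?(ltW q0)// ler_wpM2l ?mulr_ge0 ?expR_ge0//.
  rewrite (_ : 6 = (2 * 3))%N// exprM; apply: lerXn2r; rewrite ?nnegrE ?exprn_ge0//.
    by rewrite addr_ge0// mulr_ge0.
  apply: (le_trans (expR_ge1Dx _)); rewrite expRM_natl.
  by apply: lerXn2r; rewrite ?nnegrE ?expR_ge0.
have E3 : expR (l ^+ 3 * expR l * (C * h)) <= expR 1.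
  rewrite ler_expR; apply: le_trans Cp1.
  rewrite (_ : C * y ^+ 4 * p = y ^+ 3 * y * (C * p)); last by ring.
  apply: ler_pM; rewrite ?mulr_ge0 ?expR_ge0 ?exprn_ge0//; last by rewrite ler_wpM2l.
  by apply: ler_pM; rewrite ?expR_ge0 ?exprn_ge0//; apply: lerXn2r.
have E4 : tilt l (q ^- 2 + 1) (- (z - e)) <= expR 2 * expR (B ^+ 2 / 2) * expR (- (z ^+ 2 / 2)).
  rewrite /tilt -!expRD ler_expR.
  have H1 : l * e <= 1.
    apply: le_trans Lp1; rewrite (_ : L * y ^+ 4 * p = y * (L * y ^+ 3 * p)); last by ring.
    exact: ler_pM.
  have H2 : l ^+ 2 * q ^- 2 <= 1.
    by rewrite -exprVn -exprMn exprn_ile1// mulr_ge0// ltW.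
  have H3 : - l * z + l ^+ 2 / 2 <= B ^+ 2 / 2 - z ^+ 2 / 2.
    rewrite /l; have [z0|z0] := leP z 0.
      have : z ^+ 2 <= B ^+ 2.
        by rewrite -sqrrN; apply: lerXn2r; rewrite ?nnegrE ?oppr_ge0//; move: Bz; clear; lra.
      by clear; lra.
    by have := sqr_ge0 B; clear; lra.
  move: H1 H2 H3; clear; lra.
have E5 := expR_sqr_tail zy.
have hq7 : h * q ^+ 7 <= p.
  have -> : h = p ^+ 43 * p ^+ 7 by rewrite /h -exprVn -exprD.
  rewrite -mulrA -exprMn mulVf ?gt_eqF// expr1n mulr1.
  by rewrite -[leRHS]expr1 ler_wiXn2l// ltW.
have t0 := tail_ge0 z.
have pk := @peak_gt0 R.
set k1 := 2 + expR 1 in E1 *.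
have k10 : 0 <= k1 by rewrite addr_ge0// expR_ge0.
apply: (@le_trans _ _ (C * h * (M * (k1 * y) * (2 * expR 9 * y ^+ 6 * q ^+ 7)) * expR 1
   * (expR 2 * expR (B ^+ 2 / 2) * (expR 2 / peak * y * tail z)))).
  have hb0 := heat_bound_ge0 l0 (ltW q0).
  have e10 : 0 <= 2 * expR l + expR (l ^+ 2 * h ^+ 2) by rewrite addr_ge0 ?mulr_ge0 ?expR_ge0.
  apply: ler_pM; rewrite ?expR_ge0//.
  - apply: mulr_ge0 (expR_ge0 _); apply: mulr_ge0; first exact: mulr_ge0.
    exact: mulr_ge0 (mulr_ge0 _ _) _.
  - apply: ler_pM; rewrite ?expR_ge0//.
      by apply: mulr_ge0; [exact: mulr_ge0|exact: mulr_ge0 (mulr_ge0 _ _) _].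
    apply: ler_wpM2l; first exact: mulr_ge0.
    apply: ler_pM => //; first exact: mulr_ge0.
    by rewrite ler_wpM2l.
  - apply: (le_trans E4); rewrite ler_wpM2l// mulr_ge0// expR_ge0.
have -> : C * h * (M * (k1 * y) * (2 * expR 9 * y ^+ 6 * q ^+ 7)) * expR 1
   * (expR 2 * expR (B ^+ 2 / 2) * (expR 2 / peak * y * tail z)) =
  2 * k1 * expR (14 + B ^+ 2 / 2) / peak * C * M * y ^+ 8 * tail z * (h * q ^+ 7).
  have -> : 14 + B ^+ 2 / 2 = 9 + 1 + 2 + 2 + B ^+ 2 / 2 by ring.
  by rewrite !expRD; ring.
have -> : 2 * k1 * expR (14 + B ^+ 2 / 2) / peak * C * M * (y ^+ 9 / q) * tail z =
  2 * k1 * expR (14 + B ^+ 2 / 2) / peak * C * M * y ^+ 8 * tail z * (y * p).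
  by rewrite -/p; ring.
apply: ler_wpM2l.
  by rewrite !mulr_ge0 ?expR_ge0 ?invr_ge0 ?(ltW pk)// exprn_ge0.
by apply: (le_trans hq7); rewrite ler_peMl// ltW.
Qed.

End shifted.

Lemma measurable_sqrt (R : realType) : measurable_fun setT (@Num.sqrt R).
Proof. by apply: continuous_measurable_fun; exact: sqrt_continuous. Qed.

(** * Upper tail of the t-statistic at the scale q *)

Section student.
Context d (T : measurableType d) (R : realType) (P : probability T R).
Implicit Types (X : T -> R) (B C L q y z e M : R).

Lemma shift_le L q y z e : 1 <= q -> 1 <= y -> 0 <= L -> `|z| <= y ->
  0 <= e <= (y ^+ 2 + 4) / q ->
  `|z| * (q^-1 + e) + L / q <= (13 + 2 * L) * y ^+ 3 / q.
Proof.
move=> q1 y1 L0 zy /andP[e0 eq].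
have q0 : 0 < q by exact: lt_le_trans q1.
have p0 : 0 < q^-1 by rewrite invr_gt0.
have y3 : y <= y ^+ 3 by rewrite -[leLHS]expr1 ler_weXn2l.
have H : `|z| * (q^-1 + e) <= y * (q^-1 + (y ^+ 2 + 4) / q).
  by apply: ler_pM => //; [rewrite addr_ge0// ltW|rewrite lerD2l].
have H1 := ler_wpM2r (ltW p0) y3.
have H2 : L / q <= L * (y ^+ 3 / q).
  by rewrite ler_wpM2l// ler_peMl ?(ltW p0)// (le_trans y1).
have H3 : 0 <= L * (y ^+ 3 / q) by rewrite mulr_ge0// mulr_ge0 ?(ltW p0)// exprn_ge0// (le_trans ler01).
have H4 : 0 <= y / q by rewrite mulr_ge0 ?(ltW p0)// (le_trans ler01).
move: H H1 H2 H3 H4; move: (q^-1) => p; clear; lra.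
Qed.

(** Relative errors of the displaced threshold ([tail_shifted]) and of Lindeberg's remainder
    ([clt_error]). *)
Definition err_const B C L M : R :=
  M * expR 3 * (13 + 2 * L)
  + 2 * (2 + expR 1) * expR (14 + B ^+ 2 / 2) / peak * C * M.

Lemma clt_shifted X C m B M L q y z e : standardized P X C -> 1 <= C -> (0 < m)%N ->
  Num.sqrt m%:R = q ^+ 50 -> 1 <= q -> expR `|z| <= y -> 0 <= B -> - B <= z ->
  0 <= L -> 0 <= M -> 1 <= M * tail (- L) -> (14 + 2 * L + C) * y ^+ 4 <= q ->
  0 <= e <= (y ^+ 2 + 4) / q ->
  (iid_pr P m (fun s => z - `|z| * (q^-1 + e) <= (Num.sqrt m%:R)^-1 * \sum_(t <- s) X t)%R <=
   ((M + err_const B C L M * (y ^+ 9 / q)) * tail z + (M + 1) * C * (Num.sqrt m%:R)^-1)%:E)%E.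
Proof.
move=> stdX C1 m0 mq q1 zy B0 Bz L0 M0 ML Lq eb.
have q0 : 0 < q by exact: lt_le_trans q1.
have zD : 1 + `|z| <= y by exact: le_trans (expR_ge1Dx _) zy.
have y1 : 1 <= y by apply: le_trans zD; rewrite lerDl.
have zy' : `|z| <= y by apply: le_trans zD; rewrite lerDr.
have C0 : 0 <= C by exact: le_trans C1.
have sh := shift_le q1 y1 L0 zy' eb.
have sq := shifted_quantile q1 y1 L0 zy' eb.
set n := `|z| * (q^-1 + e) in sh sq *.
have n0 : 0 <= n.
  by case/andP: eb => e0 _; rewrite mulr_ge0// addr_ge0// invr_ge0 ltW.
set LL := 13 + 2 * L in sh sq.
have LL0 : 0 <= LL by rewrite addr_ge0// mulr_ge0.
have l0 : 0 <= Num.max z 0 by rewrite le_max lexx orbT.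
have := @clt_upper _ T R P X C m M L (Num.max z 0) q (z - n - L / q) stdX C1 m0 q1 l0 M0 ML.
rewrite /= subrK => H; apply: (le_trans H) => {H}.
have Lq1 : (LL + C + 1) * y ^+ 4 <= q.
  by apply: le_trans Lq; rewrite /LL; apply: ler_wpM2r; [rewrite exprn_ge0// (le_trans ler01)|lra].
have Lq2 : LL * y ^+ 4 <= q.
  apply: le_trans Lq1; apply: ler_wpM2r; first by rewrite exprn_ge0// (le_trans ler01).
  by rewrite -addrA lerDl addr_ge0.
have Lp0 : 0 <= L / q by rewrite divr_ge0// ltW.
have e0' : 0 <= n + L / q by rewrite addr_ge0.
have := @clt_error R B C M LL q y z (n + L / q) C1 M0 LL0 q1 zy B0 Bz e0' sh Lq1.
rewrite (_ : z - (n + L / q) = z - n - L / q); last by rewrite opprD addrA.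
move=> H.
have Ht : heat (q ^- 2 + 1) (- (z - n - L / q)) <= (1 + expR 3 * LL * y ^+ 4 / q) * tail z.
  rewrite /heat mulNr opprK; apply: le_trans (tail_shifted q1 zy LL0 Lq2).
  exact: tail_nincr.
have t0 := tail_ge0 z.
have y49 : expR 3 * LL * y ^+ 4 / q <= expR 3 * LL * (y ^+ 9 / q).
  rewrite -mulrA ler_wpM2l ?mulr_ge0 ?expR_ge0// ler_wpM2r ?invr_ge0 ?(ltW q0)//.
  by rewrite ler_weXn2l.
have Ht2 := ler_wpM2l M0 (le_trans Ht (ler_wpM2r t0 (lerD (lexx 1) y49))).
rewrite lee_fin mq; move: H Ht2; rewrite /err_const -/LL.
move: (heat _ _) (tail z) (y ^+ 9 / q) => u t w.
move: (_ * tilt _ _ _) => E H1 H2.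
rewrite [leRHS](_ : _ = M * ((1 + expR 3 * LL * w) * t) + (M + 1) * (C * q ^- 50) +
  2 * (2 + expR 1) * expR (14 + B ^+ 2 / 2) / peak * C * M * w * t); last by ring.
by apply: lerD => //; rewrite lerD2r.
Qed.

(** Rejection by the t-test, cross-multiplied as in [rejects]. Since sum (X - mean)^2 = sum X^2 -
    (sum X)^2 / m for m draws, the root is the sample standard deviation. *)
Definition student_event X m z : set (seq T) := fun s =>
  z * Num.sqrt (m.-1%:R^-1 * (\sum_(t <- s) X t ^+ 2
                              - ((Num.sqrt m%:R)^-1 * \sum_(t <- s) X t) ^+ 2))
    < (Num.sqrt m%:R)^-1 * \sum_(t <- s) X t.

Lemma seq_measurable_student_event X m z : measurable_fun setT X ->
  seq_measurable (student_event X m z).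
Proof.
move=> mX.
have mX2 : measurable_fun setT (fun t => X t ^+ 2) by exact: measurable_funX.
have m1 : seq_measurable_fun (fun s => (Num.sqrt m%:R)^-1 * \sum_(t <- s) X t : R).
  by move=> N; apply: measurable_funM => //; exact: seq_measurable_fun_sum.
apply: seq_measurable_lt => // N; apply: measurable_funM => //.
apply: (measurableT_comp (@measurable_sqrt R)).
apply: measurable_funM => //; apply: measurable_funB; first exact: seq_measurable_fun_sum.
by apply: measurable_funX; exact: m1.
Qed.

End student.

Section student_bound.
Context d (T : measurableType d) (R : realType) (P : probability T R).
Implicit Types (X : T -> R) (B C L q y z e M : R).

Lemma expRN_le_inv (x : R) : 0 < x -> expR (- x) <= x^-1.
Proof.
move=> x0; rewrite expRN lef_pV2 ?posrE ?expR_gt0//.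
by apply: le_trans (expR_ge1Dx x); rewrite lerDr.
Qed.

Lemma sum_sqr_small X C m q : standardized P X C -> 1 <= C -> 1 <= q ->
  Num.sqrt m%:R = q ^+ 50 ->
  (iid_pr P m (fun s => \sum_(t <- s) X t ^+ 2 <= m%:R * (1 - q^-1))%R <=
     (8 * C ^+ 2 * (Num.sqrt m%:R)^-1)%:E)%E.
Proof.
move=> stdX C1 q1 mq.
have q0 : 0 < q by exact: lt_le_trans q1.
have C0 : 0 < C by exact: lt_le_trans C1.
have mE : m%:R = q ^+ 100 :> R by rewrite -[LHS]sqr_sqrtr// mq -exprM.
(* With this a the term C a^3 is half of a^2 / q, leaving the exponent - m a^2 / (2 q). *)
have a0 : 0 <= (2 * C * q)^-1 by rewrite invr_ge0 !mulr_ge0// ltW.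
apply: le_trans (sum_sqr_lower m q^-1 stdX a0) _.
rewrite lee_fin mq mE.
have -> : q ^+ 100 * (C * (2 * C * q)^-1 ^+ 3 - (2 * C * q)^-1 ^+ 2 / q) =
   - (q ^+ 97 / (8 * C ^+ 2)).
  rewrite (_ : q ^+ 100 = q ^+ 97 * q ^+ 3); last by rewrite -exprD.
  by field; rewrite !gt_eqF.
have qC : 0 < q ^+ 97 / (8 * C ^+ 2) by rewrite divr_gt0 ?exprn_gt0// mulr_gt0// exprn_gt0.
apply: (le_trans (expRN_le_inv qC)); rewrite invf_div ler_wpM2l//.
  by rewrite mulr_ge0// exprn_ge0// ltW.
by rewrite lef_pV2 ?posrE ?exprn_gt0// ler_weXn2l.
Qed.

(** With a = q ^ -40, m a^3 = q ^ -20 is small while m a^2 / q = q ^ 19 is large. The bound O(1 / q)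
    is much weaker than 1 / sqrt m; it serves negative z, where [tail z] is at least [tail 0] and
    makes it a relative error. *)
Lemma sum_sqr_large X C m q : standardized P X C -> 1 <= C -> 1 <= q ->
  Num.sqrt m%:R = q ^+ 50 ->
  (iid_pr P m (fun s => m%:R * (1 + q^-1) <= \sum_(t <- s) X t ^+ 2)%R <=
     ((C + expR (expR 1 * C)) / q)%:E)%E.
Proof.
move=> stdX C1 q1 mq.
have q0 : 0 < q by exact: lt_le_trans q1.
have C0 : 0 < C by exact: lt_le_trans C1.
have mE : m%:R = q ^+ 100 :> R by rewrite -[LHS]sqr_sqrtr// mq -exprM.
have a0 : 0 <= q ^- 40 by rewrite invr_ge0 exprn_ge0// ltW.
have e1 := @expR_ge0 R 1.
apply: le_trans (sum_sqr_upper m q^-1 stdX a0) _.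
rewrite lee_fin mE.
have p20 : q ^- 20 <= q^-1.
  by rewrite lef_pV2 ?posrE ?exprn_gt0// -[leLHS]expr1 ler_weXn2l.
have qm (k : nat) : q ^+ k * q ^- k = 1 by rewrite divff// gt_eqF// exprn_gt0.
have -> : q ^+ 100 * (q ^- 40 ^+ 3 * C) = q ^- 20 * C.
  rewrite mulrA; congr (_ * _).
  by rewrite -!exprVn -!exprM (_ : (40 * 3 = 100 + 20)%N)// exprD mulrA -exprMn divff ?gt_eqF// expr1n mul1r.
have -> : q ^+ 100 * (expR 1 * C * q ^- 40 ^+ 3 - q ^- 40 ^+ 2 / q) = expR 1 * C * q ^- 20 + - q ^+ 19.
  have -> : q ^- 40 ^+ 3 = q ^- 100 * q ^- 20 by rewrite -!exprVn -!exprM -exprD.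
  have -> : q ^- 40 ^+ 2 / q = q ^- 81 by rewrite -!exprVn -!exprM -exprSr.
  have E1 := qm 100%N; have E2 := qm 81%N.
  have E3 : q ^+ 100 = q ^+ 19 * q ^+ 81 by rewrite -exprD.
  rewrite mulrBr mulrCA (mulrA (q ^+ 100) (q ^- 100)) E1 mul1r; congr (_ - _).
  by rewrite E3 -mulrA E2 mulr1.
rewrite expRD mulrDl (mulrC C); apply: lerD; first by rewrite ler_wpM2r// ltW.
apply: ler_pM; rewrite ?expR_ge0//.
  rewrite ler_expR ler_piMr ?mulr_ge0// ?(ltW C0)//.
  by rewrite invf_le1 ?exprn_gt0// exprn_ege1.
apply: le_trans (expRN_le_inv (exprn_gt0 _ q0)) _.
by rewrite lef_pV2 ?posrE ?exprn_gt0// -[leLHS]expr1 ler_weXn2l.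
Qed.

Lemma student_bound X C m B M L q y z : standardized P X C -> 1 <= C -> (1 < m)%N ->
  Num.sqrt m%:R = q ^+ 50 -> 1 <= q -> expR `|z| <= y -> 0 <= B -> - B <= z ->
  0 <= L -> 0 <= M -> 1 <= M * tail (- L) -> (14 + 2 * L + C) * y ^+ 4 <= q ->
  (iid_pr P m (student_event X m z) <=
   ((M + (err_const B C L M + (C + expR (expR 1 * C)) / tail 0) * (y ^+ 9 / q)) * tail z
    + ((M + 1) * C + 8 * C ^+ 2) * (Num.sqrt m%:R)^-1)%:E)%E.
Proof.
move=> stdX C1 m1 mq q1 zy B0 Bz L0 M0 ML Lq.
have q0 : 0 < q by exact: lt_le_trans q1.
have m0 : (0 < m)%N by exact: ltnW.
have mX := std_measurable stdX.
have mE : m%:R = q ^+ 100 :> R by rewrite -[LHS]sqr_sqrtr// mq -exprM.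
have zD : 1 + `|z| <= y by exact: le_trans (expR_ge1Dx _) zy.
have y1 : 1 <= y by apply: le_trans zD; rewrite lerDl.
have zy' : `|z| <= y by apply: le_trans zD; rewrite lerDr.
have C0 : 0 < C by exact: lt_le_trans C1.
have mX2 : measurable_fun setT (fun t => X t ^+ 2) by exact: measurable_funX.
have mS2 : seq_measurable_fun (fun s => \sum_(t <- s) X t ^+ 2) by exact: seq_measurable_fun_sum.
have mu : seq_measurable_fun (fun s => (Num.sqrt m%:R)^-1 * \sum_(t <- s) X t : R).
  by move=> N; apply: measurable_funM => //; exact: seq_measurable_fun_sum.
have mcst (c : R) : seq_measurable_fun (fun _ : seq T => c) by move=> N; exact: measurable_cst.
have mr : m%:R^-1 <= q^-1 :> R.
  by rewrite mE lef_pV2 ?posrE ?exprn_gt0// -[leLHS]expr1 ler_weXn2l.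
have qi : 0 <= q^-1 <= 1 by rewrite invr_ge0 (ltW q0) invf_le1.
have h0 : 0 <= (Num.sqrt m%:R)^-1 :> R by rewrite invr_ge0.
have yq : q^-1 <= y ^+ 9 / q by rewrite ler_peMl ?exprn_ege1//; case/andP: qi.
have t0 : 0 < tail 0 :> R by exact: tail_gt0.
set V := (C + expR (expR 1 * C)).
have V0 : 0 <= V by rewrite addr_ge0 ?expR_ge0// ltW.
have E : (M + (err_const B C L M + V / tail 0) * (y ^+ 9 / q)) * tail z
    + ((M + 1) * C + 8 * C ^+ 2) * (Num.sqrt m%:R)^-1 =
  (M + err_const B C L M * (y ^+ 9 / q)) * tail z + (M + 1) * C * (Num.sqrt m%:R)^-1 +
  (V / tail 0 * (y ^+ 9 / q) * tail z + 8 * C ^+ 2 * (Num.sqrt m%:R)^-1) by ring.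
have split (A D : set (seq T)) (a e : R) : seq_measurable A -> seq_measurable D ->
    (forall s, student_event X m z s -> A s \/ D s) ->
    (iid_pr P m A <= a%:E)%E -> (iid_pr P m D <= e%:E)%E ->
    (iid_pr P m (student_event X m z) <= (e + a)%:E)%E.
  move=> mA mD AD Aa De; apply: (@le_trans _ _ (iid_pr P m (A `|` D))).
    apply: iid_pr_le => [||s _]; [exact: seq_measurable_student_event|exact: seq_measurableU|].
    exact: AD.
  apply: (le_trans (iid_pr_setU _ _ mA mD)).
  by rewrite addrC EFinD; exact: leeD.
have [z0|z0] := leP 0 z.
  (* The numerator y^2 + 4 serves both signs of z: it covers z^2 / m here and 4 / m below. *)
  have eb : 0 <= z ^+ 2 / m%:R <= (y ^+ 2 + 4) / q.
    apply/andP; split; first by rewrite divr_ge0 ?sqr_ge0.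
    apply: ler_pM => //; rewrite ?invr_ge0 ?sqr_ge0//.
    rewrite -[z ^+ 2]real_normK ?num_real//.
    by apply: (@le_trans _ _ (y ^+ 2)); [apply: lerXn2r; rewrite ?nnegrE// (le_trans ler01)|rewrite lerDl].
  apply: le_trans (split _ _ _ _ _ _ _ (sum_sqr_small stdX C1 q1 mq)
      (clt_shifted stdX C1 m0 mq q1 zy B0 Bz L0 M0 ML Lq eb)) _.
  - exact: seq_measurable_le.
  - exact: seq_measurable_le.
  - move=> s Hs; have [?|H] := leP (\sum_(t <- s) X t ^+ 2) (m%:R * (1 - q^-1)); first by left.
    by right; rewrite ger0_norm//; apply: studentized_ge0 (ltW H) Hs => //; case/andP: qi.
  - rewrite lee_fin E lerD2l lerDr.
    by rewrite !mulr_ge0 ?tail_ge0 ?invr_ge0 ?exprn_ge0 ?(ltW q0) ?(ltW t0)// (le_trans ler01).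
have eb : 0 <= (4 / m%:R : R) <= (y ^+ 2 + 4) / q.
  apply/andP; split; first by rewrite divr_ge0.
  by apply: ler_pM => //; rewrite ?invr_ge0// lerDr sqr_ge0.
apply: le_trans (split _ _ _ _ _ _ _ (sum_sqr_large stdX C1 q1 mq)
    (clt_shifted stdX C1 m0 mq q1 zy B0 Bz L0 M0 ML Lq eb)) _.
- exact: seq_measurable_le.
- exact: seq_measurable_le.
- move=> s Hs; have [?|H] := leP (m%:R * (1 + q^-1)) (\sum_(t <- s) X t ^+ 2); first by left.
  by right; rewrite ltr0_norm// mulNr opprK; exact: (studentized_lt0 m1 z0 qi (ltW H) Hs).
- rewrite lee_fin E lerD2l; apply: (@le_trans _ _ (V / tail 0 * (y ^+ 9 / q) * tail z)).
    rewrite (_ : _ * tail z = V * (y ^+ 9 / q) * (tail z / tail 0)); last by ring.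
    rewrite -[leLHS]mulr1; apply: ler_pM => //.
    + by rewrite mulr_ge0// ; case/andP: qi.
    + by rewrite ler_wpM2l.
    + by rewrite ler_pdivlMr// mul1r tail_nincr// ltW.
  by rewrite lerDl mulr_ge0// mulr_ge0// exprn_ge0// ltW.
Qed.

End student_bound.

(** * Choice of the scale and the uniform asymptotic bound *)

Section asymptotics.
Context {R : realType}.
Implicit Types (a w z A B C L M : R) (m : nat).

(** The solution w of exp (50 w^2) = sqrt m. The 50 is 10^2 / 2, so that the Gaussian tail at 10 w
    is at most 1 / sqrt m as soon as 10 w >= 1. *)
Definition log_scale m : R := Num.sqrt (ln (Num.sqrt m%:R) / 50).

Lemma log_scale_ge A : exists N, forall m, (N <= m)%N -> A <= log_scale m.
Proof.
exists (Num.trunc (expR (100 * A ^+ 2))).+1 => m Nm.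
have H : expR (100 * A ^+ 2) <= m%:R.
  apply: (@le_trans _ _ (Num.trunc (expR (100 * A ^+ 2))).+1%:R); last by rewrite ler_nat.
  by apply: ltW; rewrite truncnS_gt.
have [A0|A0] := leP A 0; first by apply: (le_trans A0); exact: sqrtr_ge0.
rewrite -[leLHS](ger0_norm (ltW A0)) -sqrtr_sqr ler_wsqrtr// ler_pdivlMr//.
have sm : expR (A ^+ 2 * 50) <= Num.sqrt m%:R.
  rewrite -[leLHS]ger0_norm ?expR_ge0// -sqrtr_sqr ler_wsqrtr//.
  apply: le_trans H; rewrite -expRM_natl ler_expR; lra.
by rewrite -ler_expR lnK// posrE; apply: lt_le_trans sm; exact: expR_gt0.
Qed.

Lemma log_scale_sqrt m : (0 < m)%N -> expR (log_scale m ^+ 2) ^+ 50 = Num.sqrt m%:R.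
Proof.
move=> m0; have s1 : 1 <= Num.sqrt m%:R :> R.
  by rewrite -[leLHS]sqrtr1 ler_wsqrtr// ler1n.
rewrite -expRM_natl sqr_sqrtr; last by rewrite divr_ge0// ln_ge0.
rewrite mulrC divfK// lnK// posrE; exact: lt_le_trans s1.
Qed.

(** The exponent 90 w - w^2 is at most - w from w = 91 on. *)
Lemma log_scale_small w : 91 <= w -> expR (10 * w) ^+ 9 / expR (w ^+ 2) <= w^-1.
Proof.
move=> w91; have w0 : 0 < w by apply: lt_le_trans w91.
apply: le_trans (expRN_le_inv w0).
rewrite -expRM_natl -expRN -expRD ler_expR.
nra.
Qed.

Lemma err_const_ge0 B C L M : 0 <= C -> 0 <= L -> 0 <= M -> 0 <= err_const B C L M.
Proof.
move=> C0 L0 M0; rewrite /err_const.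
have pk := @peak_gt0 R.
have e1 := @expR_ge0 R.
apply: addr_ge0.
  by apply: mulr_ge0; [exact: mulr_ge0|rewrite addr_ge0// mulr_ge0].
apply: mulr_ge0 => //; apply: mulr_ge0 => //; apply: mulr_ge0; last by rewrite invr_ge0 ltW.
by apply: mulr_ge0 => //; apply: mulr_ge0 => //; rewrite addr_ge0.
Qed.

Lemma student_asymptotic a C e : 0 < a < 1 -> 1 <= C -> 0 < e ->
  exists K : R, exists N, forall m, (N <= m)%N ->
  forall d (T : measurableType d) (P : probability T R) (X : T -> R) c,
    standardized P X C -> 0 < c <= a ->
  (iid_pr P m (student_event X m (std_normal_quantile (1 - c))) <=
    ((1 + e) * c + K * (Num.sqrt m%:R)^-1)%:E)%E.
Proof.
move=> /andP[a0 a1] C1 e0.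
have C0 : 0 <= C by exact: le_trans C1.
(* Half of e pays for smoothing, the other half for the error of order y ^ 9 / q. *)
pose M := 1 + e / 2.
have M1 : 1 < M by rewrite ltrDl divr_gt0.
have M0 : 0 < M by exact: lt_trans M1.
have [t tM] : exists t : R, M^-1 < tail t.
  have [|t ht] := @tail_cvg1 R (1 - M^-1); first by rewrite subr_gt0 invf_lt1.
  by exists t; move: ht; rewrite opprB addrC subrK.
pose L := Num.max 0 (- t).
have L0 : 0 <= L by rewrite le_max lexx.
have ML : 1 <= M * tail (- L).
  rewrite mulrC -ler_pdivrMr// mul1r (le_trans (ltW tM))// tail_nincr//.
  by rewrite lerNl le_max lexx orbT.
have [t' ta] : exists t : R, a < tail t.
  have [|t' ht] := @tail_cvg1 R (1 - a); first by rewrite subr_gt0.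
  by exists t'; move: ht; rewrite opprB addrC subrK.
(* - B bounds from below the quantiles of all levels up to a. *)
pose B := `|t'|.
have B0 : 0 <= B by exact: normr_ge0.
pose K1 := err_const B C L M + (C + expR (expR 1 * C)) / tail 0.
have K10 : 0 <= K1.
  by rewrite addr_ge0 ?err_const_ge0 ?(ltW M0)// divr_ge0 ?tail_ge0// addr_ge0// expR_ge0.
pose K2 := (M + 1) * C + 8 * C ^+ 2.
pose K3 := 14 + 2 * L + C.
have K30 : 0 <= K3 by rewrite addr_ge0// addr_ge0// mulr_ge0.
have [N HN] := log_scale_ge (91 + B + 2 * K1 / e + K3 + a^-1).
exists (1 + e + K2), (maxn 2 N) => m; rewrite geq_max => /andP[m1 Nm].
move=> d T P X c stdX /andP[c0 ca].
have {HN} := HN m Nm; set w := log_scale m => wA.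
have ke0 : 0 <= 2 * K1 / e by rewrite divr_ge0 ?mulr_ge0// ltW.
have ai0 : 0 < a^-1 by rewrite invr_gt0.
have [w91 [wB [wK1 [wK3 wa]]]] : 91 <= w /\ B <= w /\ 2 * K1 / e <= w /\ K3 <= w /\ a^-1 <= w.
  by move: wA B0 ke0 K30 ai0; move: (a^-1) (2 * K1 / e); clear; move=> ? ?; lra.
have w0 : 0 < w by exact: lt_le_trans w91.
have m0 : (0 < m)%N by exact: ltnW.
pose q := expR (w ^+ 2); pose y := expR (10 * w).
have mq : Num.sqrt m%:R = q ^+ 50 by rewrite log_scale_sqrt.
have q1 : 1 <= q by rewrite -expR0 ler_expR sqr_ge0.
have q0 : 0 < q by exact: expR_gt0.
have y1 : 1 <= y by rewrite -expR0 ler_expR mulr_ge0// ltW.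
have yq : y ^+ 9 / q <= w^-1 by exact: log_scale_small.
set h := (Num.sqrt m%:R)^-1.
have h0 : 0 < h by rewrite invr_gt0 sqrtr_gt0 ltr0n.
have ha : h <= a.
  have : h <= w^-1.
    rewrite /h mq lef_pV2 ?posrE ?exprn_gt0//.
    apply: (@le_trans _ _ q); last by rewrite -[leLHS]expr1 ler_weXn2l.
    apply: le_trans (expR_ge1Dx _); rewrite expr2; nra.
  move=> /le_trans; apply; rewrite -[leRHS]invrK lef_pV2 ?posrE//.
(* A level below 1 / sqrt m is raised to it, which only enlarges the event and costs (1 + e) / sqrt
   m, part of the constant. *)
set c' := Num.max c h.
have c'0 : 0 < c' by rewrite lt_max c0.
have c'a : c' <= a by rewrite ge_max ca.
have c'1 : c' < 1 by exact: le_lt_trans a1.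
have cc' : c <= c' by rewrite le_max lexx.
set z := std_normal_quantile (1 - c').
have zc : z <= std_normal_quantile (1 - c) by exact: quantile_nincr.
have zB : - B <= z.
  apply: (@le_trans _ _ t'); first by rewrite lerNl /B -normrN ler_norm.
  by apply: le_quantile; rewrite ?c'0// (le_lt_trans c'a).
have zw : z <= 10 * w.
  apply: quantile_le; rewrite ?c'0//.
  apply: (le_trans (tail_le_expR _)); first by move: w91; clear; lra.
  rewrite le_max; apply/orP; right.
  rewrite /h mq /q -expRM_natl -expRN ler_expR lerN2 exprMn.
  by rewrite (_ : 10 ^+ 2 * w ^+ 2 / 2 = 50%:R * w ^+ 2)//; field.
have zy : expR `|z| <= y.
  rewrite ler_expR ler_norml zw andbT; apply: le_trans zB; rewrite lerN2.
  by move: wB w0; clear; lra.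
have Lq : K3 * y ^+ 4 <= q.
  have : K3 * (y ^+ 9 / q) <= 1.
    by apply: (le_trans (ler_wpM2l K30 yq)); rewrite ler_pdivrMr// mul1r.
  rewrite mulrA ler_pdivrMr// mul1r; apply: le_trans; rewrite ler_wpM2l//.
  by rewrite ler_weXn2l.
have {zB zw zy Lq} := student_bound stdX C1 m1 mq q1 zy B0 zB L0 (ltW M0) ML Lq.
rewrite -/K1 -/K2 -/h => SB.
have mX := std_measurable stdX.
apply: (@le_trans _ _ (iid_pr P m (student_event X m z))).
  apply: iid_pr_le => [||s _]; [exact: seq_measurable_student_event|exact: seq_measurable_student_event|].
  by move=> /(le_lt_trans _); apply; rewrite ler_wpM2r// sqrtr_ge0.
apply: (le_trans SB); rewrite lee_fin.
have tz : tail z <= c' by apply: tail_quantile_le; rewrite c'0.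
have ch : c' <= c + h.
  by rewrite ge_max lerDl lerDr (ltW h0) (ltW c0).
have Mk : M + K1 * (y ^+ 9 / q) <= 1 + e.
  have : K1 * (y ^+ 9 / q) <= e / 2.
    apply: (le_trans (ler_wpM2l K10 yq)); rewrite ler_pdivrMr//.
    move: wK1; rewrite ler_pdivrMr//; clear; lra.
  by rewrite /M; clear; lra.
have H1 : (M + K1 * (y ^+ 9 / q)) * tail z <= (1 + e) * (c + h).
  apply: ler_pM => //; rewrite ?tail_ge0//; last exact: le_trans ch.
  by rewrite addr_ge0 ?(ltW M0)// mulr_ge0// divr_ge0 ?(ltW q0)// exprn_ge0// (le_trans ler01).
by move: H1; clear; move: (_ * tail z) => x; lra.
Qed.

End asymptotics.

(** * The DA test *)

Section sample.
Context (R : realType) (d : nat).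
Implicit Types (P : probability (d.-tuple R) R) (S : seq (d.-tuple R)) (j k r : 'I_d).

Definition diff j k (x : d.-tuple R) : R := tnth x j - tnth x k.

Lemma dot_contrast j k (u : 'cV[R]_d) : dot (contrast R j k) u = u j 0 - u k 0.
Proof.
by rewrite /dot /contrast linearB/= mulmxBl !trmx_delta -!rowE !mxE.
Qed.

Lemma W_diff P r k x : W P r k x = diff r k x - (mean P r 0 - mean P k 0).
Proof. by rewrite /W dot_contrast !mxE /diff; ring. Qed.

Lemma sample_meanE S k : sample_mean S k 0 = (size S)%:R^-1 * \sum_(x <- S) tnth x k.
Proof.
by rewrite /sample_mean !mxE summxE; congr (_ * _); apply: eq_bigr => x _; rewrite mxE.
Qed.

Lemma dot_sample_mean S j k :
  dot (contrast R j k) (sample_mean S) = (size S)%:R^-1 * \sum_(x <- S) diff j k x.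
Proof. by rewrite dot_contrast !sample_meanE -mulrBr sumrB. Qed.

Lemma contrast_varE S j k : contrast_var S j k =
  (size S).-1%:R^-1 * \sum_(x <- S) (diff j k x - (size S)%:R^-1 * \sum_(x <- S) diff j k x) ^+ 2.
Proof.
rewrite /contrast_var /sample_cov -scalemxAl /dot -scalemxAr mxE; congr (_ * _).
rewrite mulmx_suml mulmx_sumr summxE; apply: eq_bigr => x _.
set v := colvec x - sample_mean S.
have vE : dot (contrast R j k) v = diff j k x - (size S)%:R^-1 * \sum_(x <- S) diff j k x.
  by rewrite -dot_sample_mean !dot_contrast !mxE /diff; ring.
have m11 (A B : 'M[R]_1) : (A *m B) 0 0 = A 0 0 * B 0 0 by rewrite mxE big_ord1.
rewrite -vE -(mulmxA v) (mulmxA _ v) m11 expr2 /dot; congr (_ * _).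
have -> : v^T *m contrast R j k = ((contrast R j k)^T *m v)^T by rewrite trmx_mul trmxK.
by rewrite mxE.
Qed.

(** The sample variance ignores the shift b and scales by a^2. For a standardized contrast X this
    brings the test to the form of [student_event]. *)
Lemma contrast_var_affine S j k (X : d.-tuple R -> R) (a b : R) :
  (0 < size S)%N -> (forall x, diff j k x = a * X x + b) ->
  contrast_var S j k = a ^+ 2 * ((size S).-1%:R^-1 * (\sum_(x <- S) X x ^+ 2
    - ((Num.sqrt (size S)%:R)^-1 * \sum_(x <- S) X x) ^+ 2)).
Proof.
move=> S0 XE; rewrite contrast_varE mulrCA; congr (_ * _).
have n0 : (size S)%:R != 0 :> R by rewrite pnatr_eq0 -lt0n.
set A := \sum_(x <- S) X x.
have -> : \sum_(x <- S) diff j k x = a * A + b * (size S)%:R.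
  by under eq_bigr do rewrite XE; rewrite big_split/= -mulr_sumr big_const_seq count_predT iter_addr_0 mulr_natr.
rewrite exprMn exprVn sqr_sqrtr//.
transitivity (\sum_(x <- S) (a ^+ 2 * X x ^+ 2 + (- 2 * a ^+ 2 * (A / (size S)%:R)) * X x
   + a ^+ 2 * (A / (size S)%:R) ^+ 2)).
  by apply: eq_bigr => x _; rewrite XE; field.
rewrite !big_split/= -!mulr_sumr -/A big_const_seq count_predT iter_addr_0 -mulr_natr.
by field.
Qed.

End sample.

(** * Standardized contrasts of the population *)

Section population.
Context (R : realType) (d : nat) (P : probability (d.-tuple R) R) (C : R).
Hypothesis PC : third_moment_class C P.
Variables (r k : 'I_d).
Hypotheses (rT : r \in Theta P) (kr : k != r).

Let EW2 : \bar R := ('E_P[(fun x => W P r k x ^+ 2)%R])%E.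

Definition sd : R := Num.sqrt (fine EW2).

Let EW2_fin : (0 < EW2 < +oo)%E. Proof. by have [_ /(_ r k rT kr)[]] := PC. Qed.

Let v0 : 0 < fine EW2.
Proof. exact: fine_gt0. Qed.

Let EW2E : (fine EW2)%:E = EW2.
Proof.
by rewrite fineK// ge0_fin_numE; case/andP: EW2_fin => // /ltW.
Qed.

Lemma sd_gt0 : 0 < sd. Proof. by rewrite sqrtr_gt0. Qed.

Let sd2 : sd ^+ 2 = fine EW2. Proof. by rewrite sqr_sqrtr// ltW. Qed.

Let sd3 : fine EW2 `^ (3 / 2) = sd ^+ 3.
Proof.
by rewrite (_ : 3 / 2 = 2^-1 * 3)%R; [rewrite powRrM powR12_sqrt ?ltW// powR_mulrn ?sqrtr_ge0|ring].
Qed.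

Let measurable_coord (j : 'I_d) : measurable_fun setT (fun x : d.-tuple R => tnth x j).
Proof. exact: measurable_tnth. Qed.

Lemma measurable_W : measurable_fun setT (W P r k).
Proof.
rewrite (_ : W P r k = fun x => diff r k x - (mean P r 0 - mean P k 0)); last first.
  by apply/funext => x; rewrite W_diff.
by apply: measurable_funB => //; exact: measurable_funB.
Qed.

Let integrable_coord (j : 'I_d) : P.-integrable setT (fun x => (tnth x j)%:E).
Proof. by have [] := PC. Qed.

Let integrable_diff : P.-integrable setT (fun x => (tnth x r)%:E - (tnth x k)%:E)%E.
Proof. exact: integrableB. Qed.

Let W_EFin x : (W P r k x)%:E = ((tnth x r)%:E - (tnth x k)%:E - (cst (mean P r 0 - mean P k 0) x)%:E)%E.
Proof. by rewrite W_diff /diff -!EFinB. Qed.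

Let integrable_cst' (c : R) : P.-integrable setT (EFin \o cst c).
Proof. exact: finite_measure_integrable_cst. Qed.

Lemma integrable_W : P.-integrable setT (EFin \o W P r k).
Proof.
pose c : R := mean P r 0 - mean P k 0.
rewrite (_ : EFin \o W P r k = (fun x => (tnth x r)%:E - (tnth x k)%:E) \-
    (EFin \o cst c))%E; last by apply/funext => x; rewrite /= W_EFin.
exact: integrableB.
Qed.

Let meanE (j : 'I_d) : (\int[P]_x (tnth x j)%:E)%E = (mean P j 0)%:E.
Proof. by rewrite mxE unlock fineK// integrable_fin_num. Qed.

Lemma integral_W : (\int[P]_x (W P r k x)%:E = 0)%E.
Proof.
under eq_integral do rewrite W_EFin.
rewrite integralB//; last exact: integrable_cst'.
rewrite integralB// !meanE.
rewrite (_ : \int[P]_x _ = (mean P r 0 - mean P k 0)%:E)%E; last first.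
  rewrite -[LHS]/(\int[P]_t cst (mean P r 0 - mean P k 0)%:E t)%E integral_cst//.
  by rewrite [X in (_ * X)%E](probability_setT P) mule1.
by rewrite -!EFinB subrr.
Qed.

(** The maximum secures the condition that the moment bound is at least 1, assumed by the tail
    estimates. *)
Lemma standardized_W : standardized P (fun x => W P r k x / sd) (Num.max 1 C).
Proof.
have s0 := sd_gt0.
have mW := measurable_W.
split.
- by apply: measurable_funM.
- rewrite (_ : EFin \o _ = fun x => (sd^-1)%:E * (EFin \o W P r k) x)%E; last first.
    by apply/funext => x /=; rewrite mulrC EFinM.
  exact: integrableZl integrable_W.
- under eq_integral do rewrite mulrC EFinM.
  by rewrite integralZl//; [rewrite integral_W mule0|exact: integrable_W].
- under eq_integral do rewrite exprMn mulrC EFinM.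
  rewrite ge0_integralZl//; last 3 first.
  + by apply/measurable_EFinP; exact: measurable_funX.
  + by move=> x _; rewrite lee_fin sqr_ge0.
  + by rewrite lee_fin exprn_ge0// invr_ge0 ltW.
  have -> : (\int[P]_x (W P r k x ^+ 2)%:E)%E = EW2 by rewrite /EW2 unlock.
  by rewrite -EW2E -EFinM -sd2 exprVn mulVf// expf_neq0// gt_eqF.
- have [_ /(_ r k rT kr)[_ H3]] := PC.
  apply: (@le_trans _ _ C%:E); last by rewrite lee_fin le_max lexx orbT.
  move: H3; rewrite -/EW2 sd3 => H3.
  apply: le_trans H3; rewrite unlock le_eqVlt; apply/orP; left; apply/eqP.
  apply: eq_integral => x _; congr EFin.
  by rewrite normrM exprMn normfV (gtr0_norm s0) exprVn.
Qed.

Lemma diff_affine x :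
  diff r k x = sd * (W P r k x / sd) + (mean P r 0 - mean P k 0).
Proof. by rewrite mulrC divfK ?gt_eqF ?sd_gt0// W_diff subrK. Qed.

(** For r in [Theta P] the mean contrast is at most 0, so dropping it only raises the numerator; the
    scale [sd] cancels on both sides. *)
Lemma test_student m z (S : seq (d.-tuple R)) : size S = m -> (0 < m)%N ->
  z * Num.sqrt (contrast_var S r k)
    < Num.sqrt m%:R * dot (contrast R r k) (sample_mean S) ->
  student_event (fun x => W P r k x / sd) m z S.
Proof.
move=> Sm m0.
have s0 := sd_gt0.
have r0 : 0 < m%:R :> R by rewrite ltr0n.
have q0 : 0 < Num.sqrt m%:R :> R by rewrite sqrtr_gt0.
have S0 : (0 < size S)%N by rewrite Sm.
rewrite (contrast_var_affine S0 diff_affine) dot_sample_mean Sm.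
rewrite sqrtrM ?sqr_ge0// sqrtr_sqr (gtr0_norm s0) /student_event.
set V := Num.sqrt (m.-1%:R^-1 * _).
under eq_bigr do rewrite diff_affine.
rewrite big_split/= -mulr_sumr big_const_seq count_predT iter_addr_0 Sm -[X in _ + X]mulr_natr.
set A := \sum_(x <- S) _.
have mu0 : mean P r 0 - mean P k 0 <= 0.
  by move: rT; rewrite inE => /forallP/(_ k); rewrite subr_le0.
move: (mean P r 0 - mean P k 0) mu0 => mu mu0.
have -> : Num.sqrt m%:R * (m%:R^-1 * (sd * A + mu * m%:R)) =
   sd * ((Num.sqrt m%:R)^-1 * A) + Num.sqrt m%:R * mu.
  rewrite -{2 3}(sqr_sqrtr (ltW r0)); field.
  by rewrite gt_eqF.
move=> H; rewrite -(ltr_pM2l s0).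
rewrite mulrCA in H; apply: (lt_le_trans H).
by rewrite gerDl mulr_ge0_le0// ltW.
Qed.

End population.

(** * Measurability of selections and random index sets *)

Section boolean_events.
Context d (T : measurableType d).
Implicit Types (A : set (seq T)).

Lemma seq_measurable_negb (b : seq T -> bool) :
  seq_measurable (fun s => b s) -> seq_measurable (fun s => ~~ b s).
Proof.
move=> mb; rewrite (_ : (fun s => _) = ~` (fun s => b s)); first exact: seq_measurableC.
by apply/seteqP; split => s /= /negP.
Qed.

Lemma seq_measurable_eqb (b : seq T -> bool) c :
  seq_measurable (fun s => b s) -> seq_measurable (fun s => b s = c).
Proof.
move=> mb; case: c => //.
rewrite (_ : (fun s => _) = (fun s => ~~ b s) :> set (seq T)); first exact: seq_measurable_negb.
by apply/seteqP; split => s /= => [->|/negbTE].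
Qed.

(** A function of finitely many events takes a given value on a finite union over truth tables. *)
Lemma seq_measurable_finite (I : finType) (U : Type) (b : I -> seq T -> bool)
    (Q : {ffun I -> bool} -> U) (u : U) :
  (forall i, seq_measurable (fun s => b i s)) ->
  seq_measurable (fun s => Q [ffun i => b i s] = u).
Proof.
move=> mb.
rewrite (_ : (fun s => _) =
    (fun s => exists f : {ffun I -> bool}, (forall i, b i s = f i) /\ Q f = u)).
  apply: seq_measurable_exists => f; apply: seq_measurableI; last exact: seq_measurable_cst.
  by apply: seq_measurable_forall => i; exact: seq_measurable_eqb.
apply/seteqP; split => s /=.
  by move=> <-; exists [ffun i => b i s]; split => // i; rewrite ffunE.
move=> [f [bf <-]]; congr Q; apply/ffunP => i; rewrite ffunE; exact: bf.
Qed.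

Lemma seq_measurable_size (A : nat -> set (seq T)) :
  (forall m, seq_measurable (A m)) -> seq_measurable (fun s => A (size s) s).
Proof.
move=> mA N.
rewrite (_ : [set D : N.-tuple T | _] = [set D : N.-tuple T | A N D]); first exact: mA.
by apply/seteqP; split => D /=; rewrite size_tuple.
Qed.

Lemma sum_iid_pr_fibres (R : realType) (P : probability T R) N (I : finType) (g : seq T -> I) :
  (forall i, seq_measurable (fun s => g s = i)) ->
  (\sum_(i : I) iid_pr P N (fun s => g s = i) <= 1)%E.
Proof.
move=> mg; rewrite -big_enum/=.
have cE i r : (fun s => g s \in i :: r) = (fun s => g s = i) `|` (fun s => g s \in r) :> set (seq T).
  apply/seteqP; split => s /=; rewrite inE; first by move=> /orP[/eqP|]; [left|right].
  by move=> [->|->]; rewrite ?eqxx ?orbT.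
have mE (r : seq I) : seq_measurable (fun s => g s \in r).
  elim: r => [|i r IH].
    rewrite (_ : (fun s => _) = (fun=> False)); first exact: seq_measurable_cst.
    by apply/seteqP; split.
  by rewrite cE; exact: seq_measurableU.
have : uniq (enum I) by exact: enum_uniq.
move=> uI; apply: le_trans (iid_pr_le1 P N (mE (enum I))).
elim: (enum I) uI => [|i r IH] /=; first by rewrite big_nil; move=> _; exact: iid_pr_ge0.
move=> /andP[ir ur]; rewrite big_cons cE.
have -> : iid_pr P N ((fun s => g s = i) `|` (fun s => g s \in r)) =
   (iid_pr P N (fun s => g s = i) + iid_pr P N (fun s => g s \in r))%E.
  apply: measureU; [exact: mg|exact: mE|].
  by apply/seteqP; split => D //= [-> gr]; rewrite gr in ir.
by rewrite leeD2l// IH.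
Qed.

End boolean_events.

Section test_measurability.
Context (R : realType) (d : nat).
Local Notation T := (d.-tuple R).
Variables (fsthalf : nat -> nat) (studentize : bool) (kappa : R).
Hypothesis kappa0 : 0 < kappa.
Implicit Types (S : seq T) (j k : 'I_d).

Lemma seq_measurable_fun_diff_sum j k :
  seq_measurable_fun (fun S : seq T => \sum_(x <- S) diff j k x).
Proof.
apply: seq_measurable_fun_sum; apply: measurable_funB; exact: measurable_tnth.
Qed.

Lemma seq_measurable_fun_mean k :
  seq_measurable_fun (fun S => (sample_mean S : 'cV[R]_d) k 0).
Proof.
rewrite (_ : (fun S => _) = (fun S => (size S)%:R^-1 * \sum_(x <- S) tnth x k)); last first.
  by apply/funext => S; rewrite sample_meanE.
apply: (seq_measurable_fun_size (h := fun n S => n%:R^-1 * \sum_(x <- S) tnth x k)) => m N.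
apply: measurable_funM => //; apply: seq_measurable_fun_sum; exact: measurable_tnth.
Qed.

Lemma seq_measurable_fun_dot j k :
  seq_measurable_fun (fun S => dot (contrast R j k) (sample_mean S)).
Proof.
rewrite (_ : (fun S => _) = (fun S => sample_mean S j 0 - sample_mean S k 0)); last first.
  by apply/funext => S; rewrite dot_contrast.
by move=> N; apply: measurable_funB; exact: seq_measurable_fun_mean.
Qed.

Lemma seq_measurable_fun_var j k : seq_measurable_fun (fun S => contrast_var S j k : R).
Proof.
rewrite (_ : (fun S => _) = (fun S => if (0 < size S)%N then (size S).-1%:R^-1 *
   (\sum_(x <- S) (diff j k x) ^+ 2
    - ((Num.sqrt (size S)%:R)^-1 * \sum_(x <- S) diff j k x) ^+ 2) else 0)); last first.
  apply/funext => S; case: ltnP => S0.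
    by rewrite (contrast_var_affine S0 (X := diff j k) (a := 1) (b := 0)) ?expr1n ?mul1r// => x; rewrite mul1r addr0.
  by move: S0; rewrite leqn0 => /eqP/size0nil ->; rewrite contrast_varE big_nil mulr0.
apply: (seq_measurable_fun_size (h := fun n S => if (0 < n)%N then n.-1%:R^-1 *
   (\sum_(x <- S) (diff j k x) ^+ 2
    - ((Num.sqrt n%:R)^-1 * \sum_(x <- S) diff j k x) ^+ 2) else 0)) => m N.
case: (0 < m)%N; last exact: measurable_cst.
apply: measurable_funM => //; apply: measurable_funB.
  apply: seq_measurable_fun_sum; apply: measurable_funX.
  by apply: measurable_funB; exact: measurable_tnth.
apply: measurable_funX; apply: measurable_funM => //.
exact: seq_measurable_fun_diff_sum.
Qed.

(** The selected index depends on f only through the comparisons between its values, a finite truth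
    table to which [seq_measurable_finite] applies. *)
Let le_table (f : 'I_d -> R) : {ffun 'I_d * 'I_d -> bool} := [ffun p => f p.1 <= f p.2].

Let table_argmin j (b : {ffun 'I_d * 'I_d -> bool}) : 'I_d :=
  odflt j [pick s | [&& s != j, [forall l, (l != j) ==> b (s, l)]
    & [forall l, (l != j) && (b (l, s) && b (s, l)) ==> (s <= l)%N]]].

Let sargmin_table j f : sargmin j f = table_argmin j (le_table f).
Proof.
rewrite /sargmin /table_argmin; congr odflt; apply: eq_pick => s /=.
congr [&& _, _ & _]; apply: eq_forallb => l; rewrite !ffunE//=.
by rewrite -eq_le.
Qed.

Lemma seq_measurable_sargmin j (f : seq T -> 'I_d -> R) k :
  (forall l, seq_measurable_fun (f ^~ l)) ->
  seq_measurable (fun S => sargmin j (f S) = k).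
Proof.
move=> mf; rewrite (_ : (fun S => _) =
   (fun S => table_argmin j [ffun p : 'I_d * 'I_d => f S p.1 <= f S p.2] = k)); last first.
  by apply/funext => S; rewrite sargmin_table.
by apply: (@seq_measurable_finite _ T _ _ (fun p S => f S p.1 <= f S p.2)) => p; exact: seq_measurable_le.
Qed.

Lemma seq_measurable_selected j k :
  seq_measurable (fun S => selected studentize kappa j S = k).
Proof.
rewrite /selected; case: studentize; apply: seq_measurable_sargmin => l; last exact: seq_measurable_fun_mean.
move=> N; apply: measurable_funM.
  by apply: measurable_funB; exact: seq_measurable_fun_mean.
(* Monotone on the whole line, because the maximum with kappa stays positive. *)
have mW : measurable_fun setT (fun x : R => (Num.max x kappa)^-1).
  apply: nonincreasing_measurable => // x y xy; rewrite lef_pV2 ?posrE ?lt_max ?kappa0 ?orbT//.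
  by rewrite ge_max !le_max xy lexx orbT.
apply: (measurableT_comp mW); apply: (measurableT_comp (@measurable_sqrt R)).
exact: seq_measurable_fun_var.
Qed.

Lemma seq_measurable_rejects j (c : R) :
  seq_measurable (fun S => rejects fsthalf studentize kappa j S c).
Proof.
rewrite /rejects.
apply: (seq_measurable_size (A := fun n S => let m := fsthalf n in
  let s := selected studentize kappa j (drop m S) in
  std_normal_quantile (1 - c) * Num.sqrt (contrast_var (take m S) j s)
    < Num.sqrt m%:R * dot (contrast R j s) (sample_mean (take m S)))) => n /=.
set m := fsthalf n.
rewrite (_ : (fun S => _) = (fun S => exists s, selected studentize kappa j (drop m S) = s /\
  std_normal_quantile (1 - c) * Num.sqrt (contrast_var (take m S) j s)
    < Num.sqrt m%:R * dot (contrast R j s) (sample_mean (take m S)))); last first.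
  apply/seteqP; split => S /=; first by move=> H; exists (selected studentize kappa j (drop m S)).
  by move=> [s [<-]].
apply: seq_measurable_exists => s; apply: seq_measurableI.
  exact: (seq_measurable_drop m (seq_measurable_selected j s)).
apply: seq_measurable_lt => N; apply: measurable_funM => //.
  apply: (measurableT_comp (@measurable_sqrt R)).
  exact: (seq_measurable_fun_take m (seq_measurable_fun_var j s)).
exact: (seq_measurable_fun_take m (seq_measurable_fun_dot j s)).
Qed.

Lemma seq_measurable_prescreened n (A : {set 'I_d}) :
  seq_measurable (fun S => prescreened fsthalf studentize kappa n S = A).
Proof.
rewrite /prescreened /confidence_set.
rewrite (_ : (fun S => _) = (fun S => (fun b : {ffun 'I_d -> bool} => finset (fun k => ~~ b k))
   [ffun k => rejects fsthalf studentize kappa k (drop n S) (Num.sqrt n%:R)^-1] = A)); last first.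
  apply/funext => S; congr (_ = _); apply/setP => k; by rewrite !inE ffunE.
apply: (@seq_measurable_finite _ T _ _
  (fun k S => rejects fsthalf studentize kappa k (drop n S) (Num.sqrt n%:R)^-1)
  (fun b : {ffun 'I_d -> bool} => finset (fun k => ~~ b k)) A) => k.
exact: (seq_measurable_drop n (seq_measurable_rejects k _)).
Qed.

Lemma seq_measurable_Theta_uni (alpha : R) n (A : {set 'I_d}) :
  seq_measurable (fun S => A \subset Theta_uni fsthalf studentize kappa alpha n S).
Proof.
rewrite (_ : (fun S => _) = (fun S => exists B, prescreened fsthalf studentize kappa n S = B /\
   forall k, k \in A -> ~~ rejects fsthalf studentize kappa k S (alpha / (maxn 1 #|B|)%:R))); last first.
  apply/seteqP; split => S /=.
    move=> /fintype.subsetP AS; exists (prescreened fsthalf studentize kappa n S); split => // k /AS.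
    by rewrite inE.
  by move=> [_ [<- H]]; apply/fintype.subsetP => k /H; rewrite inE.
apply: seq_measurable_exists => B; apply: seq_measurableI; first exact: seq_measurable_prescreened.
apply: seq_measurable_forall => k; apply: seq_measurable_imply.
by apply: seq_measurable_negb; exact: seq_measurable_rejects.
Qed.

End test_measurability.

(** * Level of a single test *)

Section test_level.
Context (R : realType).

Lemma sargmin_neq d (j : 'I_d) (f : 'I_d -> R) : (2 <= d)%N -> sargmin j f != j.
Proof.
move=> d2.
have [l0 l0j] : exists l0 : 'I_d, l0 != j.
  have [j0|j0] := eqVneq (j : nat) 0%N.
    by exists (Ordinal d2); rewrite -val_eqE/= j0.
  by exists (Ordinal (ltnW d2)); rewrite -val_eqE/= eq_sym.
rewrite /sargmin; case: pickP => [s /and3P[]//|] none; exfalso.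
(* A minimiser among the indices other than j, then the smallest index that ties with it: [pick]
   cannot fail. *)
have [s0 s0j min0] := @Order.TotalTheory.arg_minP _ R _ l0 (fun s => s != j) f l0j.
have [s /andP[sj /eqP fs] mins] := @arg_minnP _ s0 (fun s => (s != j) && (f s == f s0)) (fun s => s : nat) (introT andP (conj s0j (eqxx _))).
have := none s; rewrite sj /= => /negP; apply; apply/andP; split; apply/forallP => l; apply/implyP.
  by move=> lj; rewrite fs min0.
by move=> /andP[lj /eqP ls]; apply: mins; rewrite lj ls fs eqxx.
Qed.

Lemma selected_neq d studentize (kappa : R) (j : 'I_d) S : (2 <= d)%N ->
  selected studentize kappa j S != j.
Proof. by move=> d2; rewrite /selected; case: ifP => _; exact: sargmin_neq. Qed.

(** Split by the value k of the selected index. It is determined by the second part of the sample,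
    so by independence each piece is at most the uniform bound times the probability of selecting
    k. *)
Lemma rejects_bound (a C e : R) : 0 < a < 1 -> 0 < e ->
  exists2 K : R, 0 <= K & exists N0, forall d (P : probability (d.-tuple R) R)
    fsthalf studentize kappa N (r : 'I_d) c,
    (2 <= d)%N -> third_moment_class C P -> 0 < kappa -> r \in Theta P ->
    (N0 <= fsthalf N <= N)%N -> 0 < c <= a ->
  (iid_pr P N (fun S => rejects fsthalf studentize kappa r S c) <=
    ((1 + e) * c + K * (Num.sqrt (fsthalf N)%:R)^-1)%:E)%E.
Proof.
move=> a01 e0.
have C1 : 1 <= Num.max 1 C by rewrite le_max lexx.
have [K [N0 HK]] := student_asymptotic a01 C1 e0.
exists `|K|; first exact: normr_ge0.
exists (maxn 1 N0) => d P fsthalf studentize kappa N r c d2 PC k0 rT.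
set m := fsthalf N => /andP[+ mN] cb; rewrite geq_max => /andP[m0 Nm].
pose X k x : R := W P r k x / sd P r k.
have {}HK k : k != r -> (iid_pr P m (student_event (X k) m
    (std_normal_quantile (1 - c)%R)) <= ((1 + e) * c + `|K| * (Num.sqrt m%:R)^-1)%:E)%E.
  move=> kr; apply: le_trans (HK m Nm _ _ P _ _ (standardized_W PC rT kr) cb) _.
  by rewrite lee_fin lerD2l ler_wpM2r ?invr_ge0// ler_norm.
set z := std_normal_quantile (1 - c) in HK.
set b := (1 + e) * c + `|K| * _ in HK *.
have b0 : 0 <= b.
  case/andP: cb => c0 _; rewrite addr_ge0// mulr_ge0 ?invr_ge0// ?(ltW c0)//.
  by rewrite addr_ge0// ltW.
pose E k : set (seq (d.-tuple R)) := student_event (X k) m z.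
pose F k : set (seq (d.-tuple R)) := fun S => selected studentize kappa r S = k.
have mF k : seq_measurable (F k) by exact: seq_measurable_selected.
have mE k : k != r -> seq_measurable (E k).
  by move=> kr; apply: seq_measurable_student_event; exact: std_measurable (standardized_W PC rT kr).
(* The conjunct k != r is kept because the contrast can be standardized only then. *)
pose G k : set (seq (d.-tuple R)) := fun S => (k != r) /\ (E k (take m S) /\ F k (drop m S)).
have mG k : seq_measurable (G k).
  have [kr|kr] := boolP (k != r); last first.
    rewrite (_ : G k = (fun=> False)); first exact: seq_measurable_cst.
    by apply/seteqP; split => // S [k'r]; rewrite k'r in kr.
  apply: seq_measurableI; first exact: seq_measurable_cst.
  by apply: seq_measurableI; [exact: seq_measurable_take (mE k kr)|exact: seq_measurable_drop (mF k)].
apply: (@le_trans _ _ (iid_pr P N (fun S => exists2 k, k \in [set: 'I_d]%SET & G k S))).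
  apply: iid_pr_le; first exact: seq_measurable_rejects.
    rewrite (_ : (fun S => _) = (fun S => exists k, G k S)); first exact: seq_measurable_exists.
    by apply/seteqP; split => S /= [k]; [move=> _; exists k|exists k; rewrite ?inE].
  move=> S SN; rewrite /rejects SN -/m => H.
  exists (selected studentize kappa r (drop m S)); first by rewrite inE.
  have kr := selected_neq studentize kappa r (drop m S) d2.
  split => //; split => //; apply: (test_student PC rT kr) => //.
  by rewrite size_take SN; case: ltnP => // Nm'; apply/eqP; rewrite eqn_leq mN Nm'.
apply: le_trans (iid_pr_exists _ _ _ mG) _.
apply: (@le_trans _ _ (\sum_(k in [set: 'I_d]%SET) b%:E * iid_pr P (N - m) (F k))%E).
  apply: lee_sum => k _; have [kr|kr] := boolP (k != r).
    rewrite -{1}(subnKC mN); apply: (@le_trans _ _ (iid_pr P m (E k) * iid_pr P (N - m) (F k))%E).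
      rewrite -(iid_pr_indep P m (N - m) (mE k kr) (mF k)).
      apply: iid_pr_le.
      - exact: mG.
      - by apply: seq_measurableI; [exact: seq_measurable_take (mE k kr)|exact: seq_measurable_drop (mF k)].
      - by move=> S _ [].
    by apply: lee_wpmul2r; [exact: iid_pr_ge0|exact: HK].
  have -> : iid_pr P N (G k) = 0%E.
    rewrite -(measure0 (iid_law P N)); congr (iid_law P N _).
    by apply/seteqP; split => // S [k'r]; rewrite k'r in kr.
  by rewrite mule_ge0 ?lee_fin// iid_pr_ge0.
rewrite -ge0_sume_distrr; last by move=> k _; exact: iid_pr_ge0.
rewrite -[leRHS]mule1; apply: lee_wpmul2l; first by rewrite lee_fin.
apply: le_trans (sum_iid_pr_fibres P (N - m) mF).
by rewrite le_eqVlt; apply/orP; left; apply/eqP; apply: eq_bigl => k; rewrite inE.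
Qed.

End test_level.

(** * Coverage of the two-step confidence set *)

Section coverage.
Context (R : realType).

Lemma rejects_nincr d fsthalf studentize (kappa : R) (r : 'I_d) S c c' :
  0 < c -> c <= c' -> c' < 1 ->
  rejects fsthalf studentize kappa r S c -> rejects fsthalf studentize kappa r S c'.
Proof.
move=> c0 cc c1; rewrite /rejects; apply: le_lt_trans.
by rewrite ler_wpM2r ?sqrtr_ge0// quantile_nincr.
Qed.

Lemma Theta_neq0 d (P : probability (d.-tuple R) R) : (0 < d)%N -> (0 < #|Theta P|)%N.
Proof.
move=> d0; have [s _ smin] := @Order.TotalTheory.arg_minP _ R _ (Ordinal d0) xpredT (fun k => mean P k 0) isT.
by apply/card_gt0P; exists s; rewrite inE; apply/forallP => l; exact: smin.
Qed.

Lemma sum_le_card d (I : finType) (T : measurableType d) (P : probability T R) N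
    (r : {set I}) (A : I -> set (seq T)) (b : R) :
  (forall i, i \in r -> (iid_pr P N (A i) <= b%:E)%E) ->
  (\sum_(i in r) iid_pr P N (A i) <= (#|r|%:R * b)%:E)%E.
Proof.
move=> H; apply: (@le_trans _ _ (\sum_(i in r) b%:E)%E); first exact: lee_sum.
by rewrite sumEFin lee_fin sumr_const mulr_natl.
Qed.

Lemma sqrt_half_le fsthalf n : (forall N, fsthalf N = N./2 \/ fsthalf N = uphalf N) ->
  (2 <= n)%N -> (Num.sqrt (fsthalf n)%:R)^-1 <= 2 * (Num.sqrt n%:R)^-1 :> R.
Proof.
move=> fh n2.
have n0 : (0 < n)%N by exact: ltnW.
have hn : (n <= 4 * fsthalf n)%N.
  apply: (@leq_trans (4 * n./2)).
    have h1 : (0 < n./2)%N by rewrite half_gt0.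
    have -> : (4 * n./2 = n./2.*2 + n./2.*2)%N by rewrite addnn -!mul2n mulnA.
    rewrite -{1}(odd_double_half n) leq_add2r.
    by apply: (leq_trans (leq_b1 _)); rewrite double_gt0.
  by rewrite leq_mul2l /=; case: (fh n) => ->; rewrite // uphalf_half leq_addl.
have m0 : (0 < fsthalf n)%N by case: (fsthalf n) hn => //; rewrite muln0 leqNgt n0.
have s2 : 2 = Num.sqrt 4 :> R by rewrite (_ : 4 = 2 ^+ 2) ?sqrtr_sqr ?ger0_norm// -natrX.
rewrite ler_pdivlMr ?sqrtr_gt0 ?ltr0n// mulrC ler_pdivrMr ?sqrtr_gt0 ?ltr0n//.
by rewrite s2 -sqrtrM// ler_wsqrtr// -natrM ler_nat.
Qed.

Lemma coverage_bound (alpha C e : R) : 0 < alpha < 1 -> 0 < e ->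
  exists2 K : R, 0 <= K & exists n0, forall d (P : probability (d.-tuple R) R)
    fsthalf studentize kappa n,
    (2 <= d)%N -> third_moment_class C P -> 0 < kappa ->
    (forall N, fsthalf N = N./2 \/ fsthalf N = uphalf N) -> (n0 <= n)%N ->
  ((1 - (1 + e) * alpha - K * (#|Theta P|%:R * (Num.sqrt n%:R)^-1))%:E <=
   iid_pr P n.*2 (fun D => Theta P \subset Theta_uni fsthalf studentize kappa alpha n D))%E.
Proof.
move=> a01 e0; have /andP[a0 a1] := a01.
have [K K0 [N0 HK]] := rejects_bound C a01 e0.
(* In units of n ^ (-1/2), each index of [Theta P] costs 1 + e + 2 K in prescreening, where halving
   a sample of size n doubles K, and K in the final test beyond its share of alpha. *)
exists (1 + e + 3 * K); first by rewrite addr_ge0 ?mulr_ge0// addr_ge0// ltW.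
(* The middle bound leaves halves of size at least N0; the last one makes the prescreening level n ^
   (-1/2) at most alpha, as [rejects_bound] requires. *)
exists (maxn 2 (maxn (2 * N0 + 2) (Num.trunc (alpha ^- 2)).+1)) => d P fsthalf studentize kappa n d2 PC k0 fh.
rewrite !geq_max => /and3P[n2 nN nA].
have n0 : (0 < n)%N by exact: ltnW.
set h := (Num.sqrt n%:R)^-1.
have h0 : 0 < h by rewrite invr_gt0 sqrtr_gt0 ltr0n.
have ha : h <= alpha.
  rewrite -[leRHS]invrK /h lef_pV2 ?posrE ?sqrtr_gt0 ?ltr0n ?invr_gt0//.
  rewrite -[leLHS]ger0_norm ?invr_ge0 ?(ltW a0)// -sqrtr_sqr ler_wsqrtr// exprVn.
  apply: (@le_trans _ _ (Num.trunc (alpha ^- 2)).+1%:R); last by rewrite ler_nat.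
  by apply: ltW; rewrite truncnS_gt.
have T0 : (0 < #|Theta P|)%N by apply: Theta_neq0; exact: ltnW.
have T0' : 0 < #|Theta P|%:R :> R by rewrite ltr0n.
have fn2 : fsthalf n.*2 = n.
  by case: (fh n.*2) => ->; rewrite ?doubleK// uphalf_double.
pose A1 r : set (seq (d.-tuple R)) := fun D => rejects fsthalf studentize kappa r (drop n D) h.
pose c := alpha / #|Theta P|%:R.
have c0 : 0 < c by rewrite divr_gt0.
have ca : c <= alpha by rewrite ler_pdivrMr// ler_peMr ?(ltW a0)// ler1n.
(* The level of the final test is random, since it depends on the data through prescreening; the
   deterministic share c of alpha stands in for it. *)
pose A2 r : set (seq (d.-tuple R)) := fun D => rejects fsthalf studentize kappa r D c.
have mA1 r : seq_measurable (A1 r).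
  exact: (seq_measurable_drop n (seq_measurable_rejects fsthalf studentize k0 r h)).
have mA2 r : seq_measurable (A2 r) by exact: seq_measurable_rejects.
pose good : set (seq (d.-tuple R)) := fun D => Theta P \subset Theta_uni fsthalf studentize kappa alpha n D.
have mgood : seq_measurable good by exact: seq_measurable_Theta_uni.
have mex (A : 'I_d -> set (seq (d.-tuple R))) : (forall r, seq_measurable (A r)) ->
    seq_measurable (fun D => exists2 r, r \in Theta P & A r D).
  move=> mA; rewrite (_ : (fun D => _) = (fun D => exists r, (r \in Theta P) /\ A r D)).
    by apply: seq_measurable_exists => r; apply: seq_measurableI => //; exact: seq_measurable_cst.
  by apply/seteqP; split => D /= [r]; [move=> ? ?; exists r|move=> [? ?]; exists r].
have bad : (iid_pr P n.*2 (~` good) <= ((1 + e) * alpha + (1 + e + 3 * K) * (#|Theta P|%:R * h))%:E)%E.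
  apply: (@le_trans _ _ (iid_pr P n.*2 ((fun D => exists2 r, r \in Theta P & A1 r D) `|`
      (fun D => exists2 r, r \in Theta P & A2 r D)))).
    apply: iid_pr_le; first exact: seq_measurableC.
      by apply: seq_measurableU; exact: mex.
    move=> D _ /negP/fintype.subsetPn[r rT]; rewrite inE negbK => rD.
    have [|nex] := pselect (exists2 r, r \in Theta P & A1 r D); first by left.
    right; exists r => //.
    (* When prescreening keeps all of [Theta P], the random level is at most c, and a rejection at a
       smaller level is also one at c. *)
    have sub : Theta P \subset prescreened fsthalf studentize kappa n D.
      apply/fintype.subsetP => k kT; rewrite inE; apply/negP => H.
      by apply: nex; exists k.
    apply: rejects_nincr rD.
    - by rewrite divr_gt0// ltr0n leq_max.
    - rewrite /c ler_wpM2l ?(ltW a0)// lef_pV2 ?posrE ?ltr0n ?leq_max// ler_nat.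
      by rewrite leq_max subset_leq_card ?orbT.
    - exact: le_lt_trans ca a1.
  apply: (le_trans (iid_pr_setU _ _ (mex _ mA1) (mex _ mA2))).
  have -> : (1 + e) * alpha + (1 + e + 3 * K) * (#|Theta P|%:R * h) =
     #|Theta P|%:R * ((1 + e) * h + K * (2 * h)) + #|Theta P|%:R * ((1 + e) * c + K * h).
    by rewrite /c; field; rewrite gt_eqF.
  rewrite EFinD; apply: leeD.
    apply: (le_trans (iid_pr_exists _ _ _ mA1)); apply: sum_le_card => r rT.
    rewrite -addnn /A1 (iid_pr_drop P n n (seq_measurable_rejects fsthalf studentize k0 r h)).
    apply: (le_trans (HK _ _ _ _ _ _ _ _ d2 PC k0 rT _ _)).
    - have hn : (N0 <= n./2)%N by rewrite geq_half_double -mul2n (leq_trans (leq_addr _ _) nN).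
      have on : (n./2 <= n)%N by rewrite leq_half_double -addnn -addnS leq_addr.
      have un : (uphalf n <= n)%N by rewrite leq_uphalf_double -addnn leq_addr.
      by case: (fh n) => ->; rewrite ?hn ?on// un andbT (leq_trans hn)// uphalf_half leq_addl.
    - by rewrite h0.
    - by rewrite lee_fin lerD2l ler_wpM2l// sqrt_half_le.
  apply: (le_trans (iid_pr_exists _ _ _ mA2)); apply: sum_le_card => r rT.
  apply: (le_trans (HK _ _ _ _ _ _ _ _ d2 PC k0 rT _ _)).
  - by rewrite fn2 -addnn leq_addr andbT (leq_trans _ nN)// mul2n -addnn -addnA leq_addr.
  - by rewrite c0.
  - by rewrite lee_fin fn2.
have fg := iid_pr_fin P n.*2 mgood.
move: bad; rewrite iid_prC// -(fineK fg) -EFinB !lee_fin; lra.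
Qed.

Lemma limn_einf_ge (u : nat -> \bar R) (a : R) :
  (forall e : R, 0 < e -> exists N, forall n, (N <= n)%N -> ((a - e)%:E <= u n)%E) ->
  (a%:E <= limn_einf u)%E.
Proof.
move=> H; have -> : limn_einf u = ereal_sup (range (einfs u)).
  by rewrite limn_einf_lim; apply/cvg_lim => //; exact: cvg_einfs_sup.
apply/lee_addgt0Pr => e e0; have [N HN] := H e e0.
rewrite -leeBlDr// -EFinB.
apply: le_trans (ereal_sup_ubound _); last by exists N.
by apply: le_ereal_inf_tmp => _ [n /= Nn <-]; exact: HN.
Qed.

End coverage.
Unset Implicit Arguments.

Theorem theorem5p1 (R : realType) (alpha C kappa : R) (studentize : bool)
    (fsthalf : nat -> nat) (d : nat -> nat)
    (Pcal : forall n : nat, set (probability ((d n).-tuple R) R)) :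
  0 < alpha < 1 -> 0 < C -> 0 < kappa ->
  (forall N, fsthalf N = N./2 \/ fsthalf N = uphalf N) ->
  (forall n, (2 <= d n)%N) ->
  (forall n P, Pcal n P -> third_moment_class C P) ->
  (fun n => sup [set (#|Theta P|%:R : R) | P in Pcal n] : R^o)
    =o_\oo (fun n => Num.sqrt n%:R : R^o) ->
  ((1 - alpha)%:E <=
   limn_einf (fun n =>
     ereal_inf [set iid_law P n.*2
                      [set D | Theta P \subset
                               Theta_uni fsthalf studentize kappa alpha n D]
               | P in Pcal n]))%E.
Proof.
move=> a01 C0 k0 fh d2 HP So; have /andP[a0 a1] := a01.
apply: limn_einf_ge => e e0.
(* Half of e is for the factor 1 + e / 2 in front of alpha, half for the term in #|Theta P| / sqrt
   n; there K + 1 replaces K, which may be 0. *)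
have [K K0 [n0 HK]] := coverage_bound C a01 (divr_gt0 e0 (ltr0n R 2)).
have K1 : 0 < 2 * (K + 1) by rewrite mulr_gt0// ltr_wpDl.
move/eqoP : So => /(_ _ (divr_gt0 e0 K1)) [N _ HN].
exists (maxn 1 (maxn n0 N)) => n; rewrite !geq_max => /and3P[n1 n0n Nn].
apply: le_ereal_inf_tmp => _ [P PP <-].
apply: le_trans (HK _ P fsthalf studentize kappa n (d2 n) (HP n P PP) k0 fh n0n).
rewrite lee_fin.
have := HN n Nn; rewrite /= => {}HN.
have Ts : #|Theta P|%:R <= e / (2 * (K + 1)) * Num.sqrt n%:R.
  apply: (@le_trans _ _ (sup [set (#|Theta P|%:R : R) | P in Pcal n])).
    (* A real [sup] is an upper bound only of a nonempty bounded set: P provides a member, and no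
       cardinality exceeds d n. *)
    apply: sup_upper_bound; last by exists P.
    split; first by exists #|Theta P|%:R, P.
    exists (d n)%:R => _ [Q _ <-]; rewrite ler_nat.
    by rewrite -[X in (_ <= X)%N]card_ord max_card.
  apply: le_trans (ler_norm _) _; apply: (le_trans HN).
  by rewrite ger0_norm// sqrtr_ge0.
have sn : 0 < Num.sqrt n%:R :> R by rewrite sqrtr_gt0 ltr0n.
rewrite (_ : 1 - (1 + e / 2) * alpha - _ =
  1 - alpha - (e / 2 * alpha + K * (#|Theta P|%:R * (Num.sqrt n%:R)^-1))); last by ring.
apply: lerB => //.
have T1 : #|Theta P|%:R * (Num.sqrt n%:R)^-1 <= e / (2 * (K + 1)) by rewrite ler_pdivrMr.
have T2 := ler_wpM2l K0 T1.
have T3 : K * (e / (2 * (K + 1))) <= e / 2.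
  rewrite (_ : K * (e / (2 * (K + 1))) = e / 2 * (K / (K + 1))); last first.
    by field; rewrite gt_eqF// ltr_wpDl.
  by rewrite ler_piMr ?divr_ge0 ?(ltW e0)// ler_pdivrMr ?ltr_wpDl// mul1r lerDl.
have T4 : e / 2 * alpha <= e / 2 by rewrite ler_piMr ?divr_ge0 ?(ltW e0)// ltW.
apply: (le_trans (lerD T4 (le_trans T2 T3))).
by rewrite -splitr.
Qed.
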